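(* Let $N\ge1$, $M\ge N$, $\sigma>0$. For every GKP-stabilizer code $(\bm S_{\rm enc},\bm M,\bm f)$ there exist gains $G_1,\dots,G_N\ge1$, a matrix $\bm\Lambda_a\in{\rm Sp}(2M,\mathbb R)$ and a measurable estimator $\bm f'$ such that the TMS code $(\bm T_{\bm G},\bm\Lambda_a\bm M,\bm f')$ has the same geometric-mean error $\bar\sigma^2_{\rm GM}$ as $(\bm S_{\rm enc},\bm M,\bm f)$. (Here $\bm\Lambda_a\bm M$ is again a symplectically integral lattice generator.)
   Context: Phase-space vectors in $\mathbb R^{2n}$ are ordered $(q_1,p_1,\dots,q_n,p_n)$; $\bm\Omega$ (of the appropriate size) $=\bigoplus\begin{pmatrix}0&1\\-1&0\end{pmatrix}$; ${\rm Sp}(2n,\mathbb R)=\{\bm S:\bm S\bm\Omega\bm S^\top=\bm\Omega\}$. For $G\ge1$, $\bm S_G=\begin{pmatrix}\sqrt G\bm I_2&\sqrt{G-1}\bm Z\\ \sqrt{G-1}\bm Z&\sqrt G\bm I_2\end{pmatrix}$, $\bm Z={\rm diag}(1,-1)$; $\bm T_{\bm G}\in{\rm Sp}(2K,\mathbb R)$ ($K=N+M$) acts as $\bm S_{G_i}$ on (data mode $i$, ancilla mode $i$), $i\le N$, and as identity on ancilla modes $N+1,\dots,M$. A symplectically integral lattice generator is an invertible $\bm M\in\mathbb R^{2M\times2M}$ with $\bm M^\top\bm\Omega\bm M=2\pi\bm A$ for an antisymmetric integer matrix $\bm A$. $R_{\sqrt{2\pi}}$ maps each real coordinate to its representative modulo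 $\sqrt{2\pi}$ in $[-\sqrt{\pi/2},\sqrt{\pi/2})$. Code model: a GKP-stabilizer code is a triple $(\bm S_{\rm enc},\bm M,\bm f)$ with $\bm S_{\rm enc}\in{\rm Sp}(2K,\mathbb R)$, $\bm M$ a symplectically integral lattice generator (the ancilla GKP lattice), and $\bm f:\mathbb R^{2M}\to\mathbb R^{2N}$ measurable. The channel noise is $\bm\xi\sim\mathcal N(0,\sigma^2\bm I_{2K})$ (iid additive Gaussian noise); after decoding the noise is $\bm x=\bm S_{\rm enc}^{-1}\bm\xi=(\bm x_d,\bm x_a)$ with $\bm x_d\in\mathbb R^{2N}$, $\bm x_a\in\mathbb R^{2M}$; the syndrome is $\bm s=R_{\sqrt{2\pi}}(\bm M^\top\bm\Omega\bm x_a)$; the residual data error is $\bm\varepsilon=\bm x_d-\bm f(\bm s)$ with $\bm V_{\rm out}=\mathbb E[\bm\varepsilon\bm\varepsilon^\top]$; the geometric-mean error is $\bar\sigma^2_{\rm GM}=(\det\bm V_{\rm out})^{1/(2N)}$. A TMS code is a code whose encoding is $\bm T_{\bm G}$ for some gains. *)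

(* Defs.v *)
From HB Require Import structures.
From mathcomp Require Import all_boot all_order all_algebra.
From mathcomp Require Import all_classical all_reals all_analysis.
Set Implicit Arguments. Unset Strict Implicit. Unset Printing Implicit Defensive.
Import Order.TTheory GRing.Theory Num.Theory.
Local Open Scope classical_set_scope.
Local Open Scope ring_scope.

Section GKP.
Variable R : realType.

(* Omega = (+) [[0,1],[-1,0]] on coordinates ordered (q1,p1,q2,p2,...);
   stated for any size m (used with even m only). *)
Definition Omega (m : nat) : 'M[R]_m :=
  \matrix_(i, j) (if ~~ odd i && (j == i.+1 :> nat) then 1
                  else if odd i && (j.+1 == i :> nat) then -1 else 0).

Definition symplectic (m : nat) (S : 'M[R]_m) : Prop :=
  S *m Omega m *m S^T = Omega m.

Definition sympl_integral (m : nat) (L : 'M[R]_m) : Prop :=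
  L \in unitmx /\
  exists A : 'M[int]_m, A^T = - A /\
    L^T *m Omega m *m L = (pi *+ 2) *: map_mx (fun z : int => z%:~R) A.

(* R_{sqrt(2 pi)}: representative modulo a = sqrt(2 pi) in [-a/2, a/2)
   (note a/2 = sqrt(pi/2)). *)
Definition Rmod (x : R) : R :=
  let a := Num.sqrt (pi *+ 2) in x - a * (Num.floor ((x + a / 2) / a))%:~R.

Definition Rmod_vec (m : nat) (v : 'cV[R]_m) : 'cV[R]_m := map_mx Rmod v.

(* Two-mode-squeezing encoding T_G on K = N + M modes: data modes first
   (coordinates 0 .. 2N-1), ancilla modes after (coordinates 2N .. 2N+2M-1).
   Data mode i and ancilla mode i (i < N) are coupled by
   S_G = [[sqrt G I2, sqrt(G-1) Z],[sqrt(G-1) Z, sqrt G I2]], Z = diag(1,-1);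
   ancilla modes N+1..M are left untouched.  G i is the gain G_{i+1}. *)
Definition TMS_enc (N M : nat) (G : nat -> R) : 'M[R]_(N.*2 + M.*2) :=
  block_mx
    (\matrix_(r < N.*2, c < N.*2) (if r == c :> nat then Num.sqrt (G r./2) else 0))
    (\matrix_(r < N.*2, c < M.*2)
       (if r == c :> nat then Num.sqrt (G r./2 - 1) * (-1) ^+ r else 0))
    (\matrix_(r < M.*2, c < N.*2)
       (if r == c :> nat then Num.sqrt (G c./2 - 1) * (-1) ^+ c else 0))
    (\matrix_(r < M.*2, c < M.*2)
       (if r == c :> nat then (if (r < N.*2)%N then Num.sqrt (G r./2) else 1)
        else 0)).

(* measurability of an estimator f : R^{2M} -> R^{2N}, R^{2M} being
   equipped with its product (= Borel) sigma-algebra (via tuples) *)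
Definition tuple_to_col (m : nat) (t : m.-tuple R) : 'cV[R]_m :=
  \col_i tnth t i.

Definition measurable_estimator (m n : nat) (f : 'cV[R]_m -> 'cV[R]_n) : Prop :=
  forall j : 'I_n,
    measurable_fun [set: m.-tuple R] (fun t => f (tuple_to_col t) j ord0).

Definition iid_gaussian_noise (d : measure_display) (T : measurableType d)
    (P : probability T R) (k : nat) (sigma : R) (xi : T -> 'cV[R]_k) : Prop :=
  (forall i : 'I_k, measurable_fun [set: T] (fun w => xi w i ord0)) /\
  (forall (i : 'I_k) (A : set R), measurable A ->
      P ((fun w => xi w i ord0) @^-1` A) = normal_prob 0 sigma A) /\
  (forall A : 'I_k -> set R, (forall i, measurable (A i)) ->
      P (\bigcap_i ((fun w => xi w i ord0) @^-1` A i)) =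
      (\prod_(i < k) P ((fun w => xi w i ord0) @^-1` A i))%E).

Variables (N M : nat).
Local Notation Kd := (N.*2 + M.*2)%N.

Definition residual (Senc : 'M[R]_Kd) (Lat : 'M[R]_(M.*2))
    (f : 'cV[R]_(M.*2) -> 'cV[R]_(N.*2)) (xi : 'cV[R]_Kd) : 'cV[R]_(N.*2) :=
  let x := invmx Senc *m xi in
  let x_d := usubmx x in
  let x_a := dsubmx x in
  x_d - f (Rmod_vec (Lat^T *m Omega (M.*2) *m x_a)).

(* the residual error has finite second moments (so V_out is defined) *)
Definition residual_L2 (d : measure_display) (T : measurableType d)
    (P : probability T R) (xi : T -> 'cV[R]_Kd) Senc Lat f : Prop :=
  forall i : 'I_(N.*2),
    P.-integrable [set: T] (fun w => ((residual Senc Lat f (xi w) i ord0) ^+ 2)%:E).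

Definition Vout (d : measure_display) (T : measurableType d)
    (P : probability T R) (xi : T -> 'cV[R]_Kd) Senc Lat f : 'M[R]_(N.*2) :=
  \matrix_(i, j) Rintegral P [set: T]
     (fun w => residual Senc Lat f (xi w) i ord0 * residual Senc Lat f (xi w) j ord0).

Definition GM_error (d : measure_display) (T : measurableType d)
    (P : probability T R) (xi : T -> 'cV[R]_Kd) Senc Lat f : R :=
  powR (\det (Vout P xi Senc Lat f)) (N.*2)%:R^-1.

End GKP.

(* Main.v *)
(* The decoded noise [Senc^-1 xi] has covariance [sigma^2 Sg] with
   [Sg = Senc^-1 Senc^-T] positive definite and symplectic.  Williamson's theorem
   for the data block of [Sg], extended to a Williamson basis of the ancilla block
   that starts from the off-diagonal block, gives local symplectic maps [Sd], [Sa]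
   and gains [G] with [(Sd (+) Sa) Sg (Sd (+) Sa)^T = T_G^-1 T_G^-T] (modewise
   entanglement of pure Gaussian states).  Hence [O = T_G (Sd (+) Sa) Senc^-1] is
   orthogonal, [O xi] has the law of [xi], and the TMS code with lattice [Sa Lat] and
   estimator [Sd f] has, on the noise [O xi], the residual [Sd residual]; its
   covariance has the same determinant because [det Sd ^ 2 = 1]. *)
Require Import Defs.
From HB Require Import structures.
From mathcomp Require Import all_boot all_order all_algebra.
From mathcomp Require Import all_classical all_reals all_analysis.
From mathcomp Require Import complex measurable_realfun ring lra zify.
Import Order.TTheory GRing.Theory Num.Theory.
Local Open Scope classical_set_scope.
Local Open Scope ring_scope.
Set Implicit Arguments. Unset Strict Implicit. Unset Printing Implicit Defensive.

(** * Symplectic normal forms *)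

Section Eigen.
Variable R : realType.
Implicit Types (m n p : nat).

(** Williamson bases chosen separately for the two diagonal blocks of [Sg] are not enough. Such a
    basis is unique only up to rotations inside a mode and mixing of modes with equal eigenvalue, so
    the off-diagonal block [C] need not become diagonal. Instead [C] dictates the ancilla basis.
    Since [Sg] is symplectic, the column pairs of [C^T] span invariant planes of [B Om], where [B]
    is the ancilla block, with the data eigenvalues, and their symplectic products are [1 - nu^2].
    They can therefore be normalised exactly where [nu > 1]. Where [nu = 1] the corresponding rows
    of [C] vanish; these modes may be completed arbitrarily, because the symplectic relation then
    forces the new eigenvalues to be 1. Gaussian noise is specified on boxes only, so its invariance
    is not read off a density on [R^k]. An orthogonal matrix is factored into plane rotations and
    sign flips; a plane rotation changes two coordinates and leaves the box conditions on the others
    alone, which reduces the claim to Lebesgue integrals in the plane. *)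

Lemma stable_eigenvector (C : numClosedFieldType) n p (W : 'M[C]_(p, n))
    (f : 'M[C]_n) :
  W != 0 -> (W *m f <= W)%MS ->
  exists (a : C) (y : 'rV_n), [/\ y != 0, (y <= W)%MS & y *m f = a *: y].
Proof.
move=> W0 Wf; pose V := row_base W.
have r0 : (0 < \rank W)%N by rewrite lt0n mxrank_eq0.
have /submxP[g Eg] : (V *m f <= V)%MS.
  by rewrite eq_row_base; apply: submx_trans Wf; rewrite submxMr // eq_row_base.
have [a /eigenvalueP[v vg v0]] := eigenvalue_closed g r0.
exists a, (v *m V); split.
- by rewrite mulmx_free_eq0 // row_base_free.
- by rewrite (submx_trans (submxMl _ _)) // eq_row_base.
- by rewrite -mulmxA Eg mulmxA vg scalemxAl.
Qed.

(* [a + i b] is a complex eigenvector of [f] in the kernel of [F], with eigenvalue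
   [al + i be]. *)
Lemma real_eigenpair n p (F : 'M[R]_(n, p)) (f : 'M[R]_n) :
  (\rank F < n)%N -> (forall y : 'rV_n, y *m F = 0 -> y *m f *m F = 0) ->
  exists (al be : R) (a b : 'rV_n),
    [/\ (a != 0) || (b != 0), a *m F = 0, b *m F = 0,
        a *m f = al *: a - be *: b & b *m f = be *: a + al *: b].
Proof.
move=> rF st; pose c := real_complex R.
have cM k l q (X : 'M[R]_(k, l)) (Y : 'M[R]_(l, q)) :
  map_mx c (X *m Y) = map_mx c X *m map_mx c Y by exact: map_mxM.
have [] := @stable_eigenvector R[i] n n (kermx (map_mx c F)) (map_mx c f).
- by rewrite kermx_eq0 /row_free mxrank_map neq_ltn rF.
- apply/sub_kermxP; rewrite -map_kermx -!cM.
  suff -> : kermx F *m f *m F = 0 by rewrite map_mx0.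
  apply/row_matrixP => i; rewrite row0 2!row_mul; apply: st.
  by rewrite -row_mul mulmx_ker row0.
move=> [al be] [y [y0 /sub_kermxP yF yf]].
pose a := map_mx (@complex.Re R) y; pose b := map_mx (@complex.Im R) y.
have yE : y = map_mx c a + 'i%C *: map_mx c b.
  apply/rowP => j; rewrite !mxE; case: (y 0 j) => s t.
  by rewrite /c /=; simpc.
exists al, be, a, b.
have sep k (u v u' v' : 'rV[R]_k) :
    map_mx c u + 'i%C *: map_mx c v = map_mx c u' + 'i%C *: map_mx c v' ->
    u = u' /\ v = v'.
  move=> E; split; apply/rowP => j; have /rowP/(_ j) := E; rewrite !mxE /c /=;
  by simpc; case.
have lin k (g : 'M[R]_(n, k)) :
    y *m map_mx c g = map_mx c (a *m g) + 'i%C *: map_mx c (b *m g).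
  by rewrite yE mulmxDl -scalemxAl !cM.
have [aF bF] : a *m F = 0 /\ b *m F = 0.
  by apply: sep; rewrite -lin yF !map_mx0 scaler0 addr0.
have [af bf] : a *m f = al *: a - be *: b /\ b *m f = be *: a + al *: b.
  apply: sep; rewrite -lin yf {1}yE; apply/rowP => j; rewrite !mxE /c /=.
  by simpc; congr (Complex _ _); ring.
split=> //; apply: contraNT y0; rewrite negb_or !negbK => /andP[/eqP a0 /eqP b0].
by rewrite yE a0 b0 !map_mx0 scaler0 addr0.
Qed.
End Eigen.

(** * Symplectic eigenpairs of a positive definite matrix *)

Section Williamson.
Variable R : realType.
Implicit Types (m n p : nat).

Definition posdef n (A : 'M[R]_n) :=
  forall v : 'rV[R]_n, v != 0 -> 0 < (v *m A *m v^T) 0 0.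

Lemma mx11_tr (A : 'M[R]_1) : A^T = A.
Proof. by apply/matrixP => i j; rewrite !mxE !ord1. Qed.

(** Acting on rows, [Om B] preserves the symplectic complement of the columns of [X], which is
    nonzero because [X] is rank deficient. The form [Q], which is the symplectic form [q] twisted by
    [Om B], is symmetric and negative definite. This makes the eigenvalue purely imaginary and keeps
    the real and imaginary parts of the eigenvector from being symplectically orthogonal. *)
Lemma symplectic_eigenpair n p (B Om : 'M[R]_n) (X : 'M[R]_(n, p)) (E : 'M[R]_p) :
  B^T = B -> posdef B -> Om^T = - Om -> Om \in unitmx ->
  (\rank X < n)%N -> B *m Om *m X = X *m E ->
  exists (nu : R) (u v : 'cV[R]_n),
    [/\ 0 < nu, (u^T *m Om *m X = 0) /\ (v^T *m Om *m X = 0),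
        u^T *m Om *m v = 1, B *m Om *m u = - (nu *: v) & B *m Om *m v = nu *: u].
Proof.
move=> Bsym Bpos OmT Omu rX BX.
have [|y yX|al [be [a [b [ab0 aX bX af bf]]]]] :=
    @real_eigenpair R n p (Om *m X) (Om *m B).
- by apply: leq_ltn_trans rX; rewrite mxrankM_maxr.
- rewrite -(mulmxA y) -(mulmxA Om) (mulmxA B) BX.
  by rewrite (mulmxA Om) mulmxA yX mul0mx.
pose q (x y : 'rV[R]_n) := (x *m Om *m y^T) 0 0.
pose Q (x y : 'rV[R]_n) := (x *m (Om *m B) *m Om *m y^T) 0 0.
have qC x y : q x y = - q y x.
  rewrite /q -[x *m Om *m _]mx11_tr !trmx_mul trmxK OmT mulNmx mulmxN !mulmxA.
  by rewrite mxE.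
have q0 x : q x x = 0 by have := qC x x; lra.
have QC x y : Q x y = Q y x.
  rewrite /Q -[x *m _ *m _ *m _]mx11_tr !trmx_mul trmxK OmT Bsym.
  by rewrite !(mulmxN, mulNmx) opprK !mulmxA.
have Qn x : x != 0 -> Q x x < 0.
  move=> x0; have : x *m Om != 0.
    by apply: contraNneq x0 => xO; rewrite -(mulmxK Omu x) xO mul0mx.
  move=> /Bpos; rewrite trmx_mul OmT mulNmx mulmxN mxE oppr_gt0.
  by rewrite /Q !mulmxA.
have Qa y : Q a y = al * q a y - be * q b y.
  by rewrite /Q /q af !mulmxBl -!scalemxAl !mxE.
have Qb y : Q b y = be * q a y + al * q b y.
  by rewrite /Q /q bf !mulmxDl -!scalemxAl !mxE.
have Qle x : Q x x <= 0.
  have [->|/Qn/ltW//] := eqVneq x 0.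
  by rewrite /Q !mul0mx mxE.
have QQ : Q a a + Q b b < 0.
  by have := Qle a; have := Qle b; case/orP: ab0 => /Qn; lra.
(* [Q a a] and [Q b b] both equal [be * q a b]. *)
have be_q : be * q a b < 0.
  by move: QQ; rewrite Qa Qb !q0 (qC b a); nra.
(* [Q a b = al * q a b] and [Q b a = al * q b a], where [Q] is symmetric and [q] antisymmetric. *)
have al0 : al = 0.
  have : al * q a b = 0.
    by have := QC a b; rewrite Qa Qb !q0 (qC b a); lra.
  move=> /eqP; rewrite mulf_eq0 => /orP[/eqP //|/eqP q_0].
  by move: be_q; rewrite q_0 mulr0 ltxx.
have colE (x z : 'rV[R]_n) (c : R) :
    x *m (Om *m B) = c *: z -> B *m Om *m x^T = - (c *: z^T).
  move=> /(congr1 trmx); rewrite !trmx_mul OmT Bsym mulmxN mulNmx linearZ /=.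
  by move=> <-; rewrite opprK.
(* The sign of [be] decides which of [a], [b] comes first; dividing both by the square root of
   [q x z] makes the pair symplectic. *)
have wlg (x z : 'rV[R]_n) (nu : R) : 0 < nu -> 0 < q x z ->
    x *m (Om *m X) = 0 -> z *m (Om *m X) = 0 ->
    x *m (Om *m B) = nu *: z -> z *m (Om *m B) = - nu *: x ->
    exists (nu : R) (u v : 'cV[R]_n),
    [/\ 0 < nu, (u^T *m Om *m X = 0) /\ (v^T *m Om *m X = 0),
        u^T *m Om *m v = 1, B *m Om *m u = - (nu *: v) & B *m Om *m v = nu *: u].
  move=> nu0 qxz xX zX xf zf.
  have trZ k (y : 'cV[R]_n) : (k *: y)^T = k *: y^T by rewrite linearZ.
  pose t := Num.sqrt (q x z).
  have t0 : t != 0 by rewrite gt_eqF // sqrtr_gt0.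
  have tt : t * t = q x z by rewrite -expr2 sqr_sqrtr // ltW.
  exists nu, (t^-1 *: x^T), (t^-1 *: z^T); split=> //.
  - split; rewrite trZ; rewrite trmxK -!scalemxAl -mulmxA ?xX ?zX scaler0 //.
  - apply/matrixP => i j; rewrite !ord1 trZ trmxK -!scalemxAl -!scalemxAr.
    transitivity (t^-1 * (t^-1 * q x z)).
      by rewrite mxE; congr (_ * _); rewrite mxE.
    by rewrite -tt mxE /=; field.
  - by rewrite -scalemxAr (colE _ _ _ xf) scalerN !scalerA mulrC.
  - by rewrite -scalemxAr (colE _ _ _ zf) scaleNr opprK !scalerA mulrC.
rewrite al0 scale0r sub0r -scaleNr in af.
rewrite al0 scale0r addr0 in bf.
have [be0|be0|be0] := ltgtP be 0.
- apply: (wlg a b (- be)) => //; last by rewrite opprK.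
    by rewrite oppr_gt0.
  by move: be_q; rewrite nmulr_rlt0.
- apply: (wlg b a be) => //.
  by move: be_q; rewrite pmulr_rlt0 // qC oppr_lt0.
- by move: be_q; rewrite be0 mul0r ltxx.
Qed.
End Williamson.

(** * Diagonal matrices against [Omega], and completion of partial Williamson bases *)

Section Extend.
Variable R : realType.
Implicit Types (m n p : nat).
Local Notation Om := (@Omega R).

(* The coordinate conjugate to [i] in its mode. *)
Definition mate (i : nat) : nat := if odd i then i.-1 else i.+1.

Lemma mate_half i : (mate i)./2 = i./2.
Proof. by rewrite /mate; case: ifP => h; lia. Qed.

Lemma odd_mate i : odd (mate i) = ~~ odd i.
Proof. by rewrite /mate; case: ifP => h; lia. Qed.

Lemma mateK i : mate (mate i) = i.
Proof. by rewrite {1}/mate odd_mate /mate; case: (boolP (odd i)) => h /=; lia. Qed.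

Lemma mate_lt i M : (mate i < M.*2)%N = (i < M.*2)%N.
Proof. by rewrite /mate; case: ifP => h; lia. Qed.

Lemma OmegaE n (i j : 'I_n) :
  Om n i j = (if odd i then -1 else 1) *+ (j == mate i :> nat).
Proof.
rewrite mxE /mate; case: (boolP (odd i)) => h /=.
  have -> : (j == i.-1 :> nat) = (j.+1 == i :> nat) by lia.
  by case: eqP.
by case: eqP.
Qed.

Lemma Omega_neq0 n (i j : 'I_n) : j != mate i :> nat -> Om n i j = 0.
Proof. by rewrite OmegaE => /negbTE ->. Qed.

Lemma tr_Omega n : (Om n)^T = - Om n.
Proof.
apply/matrixP => i j; rewrite mxE [in RHS]mxE !OmegaE.
have -> : (i == mate j :> nat) = (j == mate i :> nat).
  by apply/eqP/eqP => ->; rewrite mateK.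
case: eqP => [->|_]; last by rewrite !mulr0n oppr0.
by rewrite odd_mate; case: odd; rewrite /= ?opprK.
Qed.

(** Rectangular and indexed by [nat], so that the four blocks of sizes 2N and 2M are described by
    the same functions of the coordinate and multiply like diagonal matrices. *)
Definition rdiag m n (h : nat -> R) : 'M[R]_(m, n) :=
  \matrix_(i, j) (if i == j :> nat then h i else 0).

Lemma eq_rdiag m n h k : (forall i, (i < m)%N -> (i < n)%N -> h i = k i) ->
  rdiag m n h = rdiag m n k.
Proof.
by move=> hk; apply/matrixP => i j; rewrite !mxE; case: eqP => // e; rewrite hk // e.
Qed.

Lemma tr_rdiag m n h : (rdiag m n h)^T = rdiag n m h.
Proof. by apply/matrixP => i j; rewrite !mxE eq_sym; case: eqP => // ->. Qed.

Lemma rdiag1 n h : (forall i, (i < n)%N -> h i = 1) -> rdiag n n h = 1%:M.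
Proof.
move=> h1; apply/matrixP => i j; rewrite !mxE -val_eqE /=.
by case: eqP => //= _; rewrite h1.
Qed.

Lemma mul_rdiag_mxE m n p h (A : 'M[R]_(n, p)) i j :
  (rdiag m n h *m A) i j =
  if @idP (i < n)%N is ReflectT lt_in then h i * A (Ordinal lt_in) j else 0.
Proof.
rewrite mxE; case: {-}_ / idP => [lt_in|nlt].
  rewrite (bigD1 (Ordinal lt_in)) //= mxE eqxx big1 ?addr0 // => k nk.
  rewrite mxE ifN ?mul0r //; apply: contraNneq nk => e.
  by apply/eqP/val_inj => /=.
rewrite big1 // => k _; rewrite mxE ifN ?mul0r //.
by apply/eqP => e; apply: nlt; rewrite e.
Qed.

Lemma rdiagM m n p h k :
  rdiag m n h *m rdiag n p k = rdiag m p (fun i => if (i < n)%N then h i * k i else 0).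
Proof.
apply/matrixP => i j; rewrite mul_rdiag_mxE !mxE.
case: {-}_ / idP => [lt|nlt]; first by rewrite mxE /= lt; case: eqP; rewrite ?mulr0.
by rewrite (negbTE (introN idP nlt)) if_same.
Qed.

Lemma rdiag_OmegaE m n h (i : 'I_m) (j : 'I_n) : (rdiag m n h *m Om n) i j =
  h i * ((if odd i then -1 else 1) *+ ((i < n)%N && (j == mate i :> nat))).
Proof.
rewrite mul_rdiag_mxE; case: {-}_ / idP => [lt|nlt]; first by rewrite OmegaE /= lt.
by rewrite (negbTE (introN idP nlt)) mulr0n mulr0.
Qed.

Lemma Omega_rdiagE m n h (i : 'I_m) (j : 'I_n) : (Om m *m rdiag m n h) i j =
  h j * ((if odd i then -1 else 1) *+ ((j < m)%N && (j == mate i :> nat))).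
Proof.
have -> : Om m *m rdiag m n h = - (rdiag n m h *m Om m)^T.
  by rewrite trmx_mul tr_rdiag tr_Omega mulNmx opprK.
rewrite mxE [in - _]mxE rdiag_OmegaE -mulrN -mulNrn.
have -> : (j == mate i :> nat) = (i == mate j :> nat).
  by apply/eqP/eqP => ->; rewrite mateK.
case: (boolP (i == mate j :> nat)) => [/eqP ->|]; last by rewrite !andbF.
by rewrite odd_mate !andbT; case: odd; rewrite /= ?opprK.
Qed.

Lemma Omega_sqr M : Om M.*2 *m Om M.*2 = - 1%:M.
Proof.
apply/matrixP => i j; rewrite !mxE.
have mi : (mate i < M.*2)%N by rewrite mate_lt.
rewrite (bigD1 (Ordinal mi)) //= big1 ?addr0 => [|k nk]; last first.
  by rewrite Omega_neq0 ?mul0r.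
rewrite !OmegaE /= eqxx mateK odd_mate -val_eqE /= eq_sym.
by case: eqP => _; case: odd => /=; rewrite ?mulr0n ?mulr1n ?mulr0 ?oppr0 //; ring.
Qed.

Lemma Omega_unit M : Om M.*2 \in unitmx.
Proof.
have := Omega_sqr M; move=> /(congr1 -%R); rewrite opprK -mulmxN => /mulmx1_unit.
by case.
Qed.

Lemma rdiag_Omega_comm n h :
  rdiag n n (fun i => h i./2) *m Om n = Om n *m rdiag n n (fun i => h i./2).
Proof.
apply/matrixP => i j; rewrite rdiag_OmegaE Omega_rdiagE !ltn_ord /=.
by case: eqP => [->|_]; rewrite ?mate_half // !mulr0n !mulr0.
Qed.

(** Inside each mode such a diagonal is a multiple of [diag(1,-1)], which anticommutes with [Om].
    This sign distinguishes the coupling blocks of two-mode squeezing from the diagonal blocks,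
    which commute. *)
Lemma rdiag_Omega_anti N M h : (N <= M)%N ->
  (forall i, (i < N.*2)%N -> h (mate i) = - h i) ->
  rdiag N.*2 M.*2 h *m Om M.*2 = - (Om N.*2 *m rdiag N.*2 M.*2 h).
Proof.
move=> NM hN; apply/matrixP => i j; rewrite [RHS]mxE rdiag_OmegaE Omega_rdiagE.
have -> : (i < M.*2)%N by have := ltn_ord i; lia.
case: eqP => [->|_]; last by rewrite !andbF !mulr0n !mulr0 oppr0.
by rewrite mate_lt ltn_ord /= hN // mulNr opprK.
Qed.

Lemma Omega_block N M :
  Om (N.*2 + M.*2) = block_mx (Om N.*2) 0 0 (Om M.*2).
Proof.
apply/matrixP => i j; rewrite OmegaE.
case: (split_ordP i) => a ->; case: (split_ordP j) => b ->;
  rewrite ?block_mxEul ?block_mxEur ?block_mxEdl ?block_mxEdr ?OmegaE ?mxE //=.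
- have := ltn_ord a; rewrite -mate_lt => h.
  by case: eqP => // e; move: h; rewrite -e; lia.
- have := ltn_ord b => h; case: eqP => // e.
  by move: h; rewrite e mate_lt; lia.
- have oE : odd (N.*2 + a) = odd a by lia.
  have -> : mate (N.*2 + a) = (N.*2 + mate a)%N.
    by rewrite /mate oE; case: ifP => h; lia.
  rewrite oE.
  by rewrite eqn_add2l.
Qed.

(* The columns of [X] of the modes in [pm] are the part of the Williamson basis
   already chosen; its other columns vanish. *)
Lemma williamson_extend M (B : 'M[R]_(M.*2)) (pm : nat -> bool) (nu : nat -> R)
    (X : 'M[R]_(M.*2)) :
  let P := rdiag M.*2 M.*2 (fun i => (pm i./2)%:R) in
  B^T = B -> posdef B ->
  X^T *m Om M.*2 *m X = P *m Om M.*2 ->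
  B *m Om M.*2 *m X = X *m rdiag M.*2 M.*2 (fun i => nu i./2) *m Om M.*2 ->
  X *m P = X -> (forall i, pm i -> 0 < nu i) ->
  exists (Y : 'M[R]_(M.*2)) (nu' : nat -> R),
    [/\ Y^T *m Om M.*2 *m Y = Om M.*2,
        B *m Om M.*2 *m Y = Y *m rdiag M.*2 M.*2 (fun i => nu' i./2) *m Om M.*2,
        Y *m P = X, forall i, (i < M)%N -> 0 < nu' i &
        forall i, pm i -> nu' i = nu i].
Proof.
move=> P BT Bp; rewrite {}/P.
have [k] := ubnP #|[pred i : 'I_M | ~~ pm i]|.
elim: k pm nu X => // k IH pm nu X; rewrite ltnS => cardk.
set P := rdiag _ _ (fun i => (pm i./2)%:R); set W := Om _.
move=> XX BX XP nupos.
case: (pickP [pred i : 'I_M | ~~ pm i]) => [i0 /= pi0|np]; last first.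
  have pmT i : (i < M)%N -> pm i.
    by move=> lt_iM; have /negbFE := np (Ordinal lt_iM).
  have P1 : P = 1%:M.
    by apply: rdiag1 => i lt_i; rewrite pmT //; lia.
  exists X, nu; split=> //.
  - by rewrite XX P1 mul1mx.
  - by move=> i /pmT/nupos.
have lt1 : (i0.*2 < M.*2)%N by rewrite ltn_double.
have lt2 : (i0.*2.+1 < M.*2)%N by have := ltn_ord i0; lia.
pose d1 : 'rV[R]_(M.*2) := delta_mx 0 (Ordinal lt1).
pose d2 : 'rV[R]_(M.*2) := delta_mx 0 (Ordinal lt2).
have dP h (d := fun j => delta_mx 0 j : 'rV[R]_(M.*2)) j :
    d j *m rdiag M.*2 M.*2 h = h j *: d j.
  apply/rowP => l; rewrite -rowE !mxE eqxx /= eq_sym -val_eqE.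
  by case: eqP => _; rewrite ?mulr1 ?mulr0.
have d1P : d1 *m P = 0 by rewrite dP /= doubleK (negbTE pi0) scale0r.
have d2P : d2 *m P = 0.
  rewrite dP (_ : (Ordinal lt2)./2 = i0) ?(negbTE pi0) ?scale0r //=.
  by rewrite -[uphalf _]/(i0.*2.+1./2); lia.
have d1W : d1 *m W = d2.
  apply/rowP => l; rewrite -rowE mxE OmegaE mxE /= odd_double /mate odd_double.
  by rewrite -val_eqE.
have d2W : d2 *m W = - d1.
  apply/rowP => l; rewrite -rowE mxE OmegaE !mxE /= /mate /= odd_double /=.
  by rewrite -val_eqE /= mulNrn.
(* The missing mode [i0] leaves a zero column in [X]. *)
have rX : (\rank X < M.*2)%N.
  rewrite ltn_neqAle rank_leq_row andbT; apply/negP => /eqP rX.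
  have Xu : X \in unitmx by rewrite -row_free_unit /row_free rX.
  have : X *m d1^T = 0 by rewrite -XP -mulmxA -[P]trmxK -trmx_mul tr_rdiag d1P trmx0 mulmx0.
  move=> /(congr1 (mulmx (invmx X))); rewrite mulKmx // mulmx0.
  move=> /matrixP /(_ (Ordinal lt1) 0); rewrite !mxE !eqxx /= => /eqP.
  by rewrite oner_eq0.
have BX' : B *m W *m X = X *m (rdiag M.*2 M.*2 (fun i => nu i./2) *m W).
  by rewrite BX mulmxA.
have [mu [u [v [mu0 [uX vX] uv Bu Bv]]]] :=
  symplectic_eigenpair BT Bp (tr_Omega _) (Omega_unit M) rX BX'.
rewrite -/W in uX vX uv Bu Bv.
have sk (x y : 'cV[R]_(M.*2)) : x^T *m W *m y = - (y^T *m W *m x).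
  by rewrite -[LHS]mx11_tr !trmx_mul trmxK tr_Omega mulNmx mulmxN mulmxA.
have sk0 (x : 'cV[R]_(M.*2)) : x^T *m W *m x = 0.
  have := sk x x => /matrixP /(_ 0 0) e; apply/matrixP => a b; rewrite !ord1.
  rewrite [X in _ = X]mxE in e; rewrite [RHS]mxE; lra.
have tX (x : 'cV[R]_(M.*2)) : x^T *m W *m X = 0 -> X^T *m W *m x = 0.
  move=> h; apply: trmx_inj; rewrite !trmx_mul trmxK tr_Omega mulNmx mulmxN mulmxA h.
  by rewrite oppr0 trmx0.
pose pm' i := (i == i0 :> nat) || pm i.
pose nu' i := if i == i0 :> nat then mu else nu i.
(* The new pair fills the two zero columns of mode [i0]. Written as rank-one updates, it interacts
   with [X] only through [uX] and [vX]. *)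
pose X' := X + u *m d1 + v *m d2.
pose P' := rdiag M.*2 M.*2 (fun i => (pm' i./2)%:R).
have PP' : P *m P' = P.
  rewrite rdiagM; apply: eq_rdiag => i lti _; rewrite lti /pm'.
  by case: (pm _); rewrite ?orbT ?mul0r ?mulr1.
have P'P : P' *m P = P by rewrite -[LHS]trmxK trmx_mul !tr_rdiag PP' tr_rdiag.
have dP'1 : d1 *m P' = d1 by rewrite dP /= doubleK /pm' eqxx scale1r.
have half2 : (i0.*2.+1)./2 = i0 by lia.
have dP'2 : d2 *m P' = d2 by rewrite dP half2 /pm' eqxx scale1r.
have P'E : P' = P + d1^T *m d1 + d2^T *m d2.
  apply/matrixP => i j; rewrite !mxE !big_ord1 !mxE !eqxx /= -!val_eqE /=.
  case: eqP => [->|ne]; last first.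
    case: eqP => e1; case: eqP => e2; case: eqP => e3; case: eqP => e4 /=;
      rewrite ?mulr0 ?mul0r ?addr0 //; by exfalso; lia.
  rewrite /pm'.
  have [->|n1] := eqVneq (j : nat) i0.*2.
    by rewrite doubleK eqxx (negbTE pi0) ltn_eqF //= mulr0 addr0 add0r mulr1.
  have [->|n2] := eqVneq (j : nat) i0.*2.+1.
    by rewrite half2 eqxx (negbTE pi0) /= mulr0 !add0r mulr1.
  have -> : (j./2 == i0) = false by apply/negbTE; lia.
  by rewrite mulr0 !addr0.
have [|||||Y [nu2 [YY BY YP nu2p nu2E]]] := IH pm' nu' X'.
- apply: leq_trans cardk; apply: proper_card; apply/properP; split.
    by apply/fintype.subsetP => i; rewrite !inE /pm' negb_or => /andP[].
  by exists i0; rewrite !inE /pm' ?eqxx.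
- have uX' : u^T *m W *m X' = d2.
    by rewrite !mulmxDr uX !mulmxA sk0 uv mul0mx mul1mx !add0r.
  have vX' : v^T *m W *m X' = - d1.
    by rewrite !mulmxDr vX !mulmxA sk0 sk uv mul0mx mulNmx mul1mx add0r addr0.
  have XX' : X^T *m W *m X' = P *m W.
    by rewrite !mulmxDr !mulmxA (tX _ uX) (tX _ vX) !mul0mx !addr0.
  have -> : X'^T = X^T + d1^T *m u^T + d2^T *m v^T.
    by rewrite !linearD /= !trmx_mul.
  rewrite -/W !mulmxDl XX' -(mulmxA d1^T) -(mulmxA d1^T (_ *m W)) uX'.
  rewrite -(mulmxA d2^T) -(mulmxA d2^T (_ *m W)) vX' -/P' P'E.
  rewrite !mulmxDl -!(mulmxA _ _ W) d1W d2W.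
  by rewrite mulmxN.
- rewrite -/W /X' !mulmxDr !mulmxA Bu Bv BX !mulmxDl.
  rewrite addrAC; congr (_ + _ + _).
  (* Passing from [nu] to [nu'] changes only the entries of mode [i0], which [X = X P]
     annihilates. *)
  + rewrite -[in LHS]XP -[in RHS]XP -!(mulmxA X); congr (_ *m (_ *m _)).
    rewrite !rdiagM; apply: eq_rdiag => i lti _; rewrite lti /nu'.
    by case: eqP => // ->; rewrite (negbTE pi0) !mul0r.
  + by rewrite -(mulmxA u) dP /= doubleK /nu' eqxx -!scalemxAr -!scalemxAl -mulmxA d1W.
  + rewrite -(mulmxA v) dP half2 /nu' eqxx -!scalemxAr -!scalemxAl -mulmxA d2W.
    by rewrite mulNmx -scalemxAl mulmxN scalerN.
- rewrite -/P' /X' !mulmxDl -!mulmxA dP'1 dP'2.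
  by rewrite -[in X *m P']XP -mulmxA PP' XP.
- move=> i; rewrite /pm' /nu'; case: eqP => //= _; exact: nupos.
exists Y, nu2; split=> //.
  rewrite -P'P mulmxA YP /X' !mulmxDl -!mulmxA d1P d2P !mulmx0 !addr0 //.
move=> i pi; rewrite nu2E /pm' ?pi ?orbT // /nu'; case: eqP => // e.
by rewrite -e pi in pi0.
Qed.
End Extend.

(** * Williamson's theorem as a congruence *)

Section Modewise.
Variable R : realType.
Implicit Types (m n p : nat).
Local Notation Om := (@Omega R).
Local Notation rdiag := (@rdiag R).

Lemma Omega_sqr_block N M : Om (N.*2 + M.*2) *m Om (N.*2 + M.*2) = - 1%:M.
Proof.
rewrite Omega_block mulmx_block !mul0mx !mulmx0 !addr0 !add0r !Omega_sqr.
by rewrite (scalar_mx_block N.*2 M.*2) opp_block_mx !oppr0.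
Qed.

(** The hypothesis exhibits [- W S^T W] as a right inverse of [S]; for a square matrix it is also a
    left inverse, and this is the transposed relation. *)
Lemma congruence_tr n (W S : 'M[R]_n) :
  W *m W = - 1%:M -> S *m W *m S^T = W -> S^T *m W *m S = W.
Proof.
move=> WW SW.
have /mulmx1C e : S *m (W *m S^T *m (- W)) = 1%:M.
  by rewrite !mulmxA SW mulmxN WW opprK.
have := congr1 (mulmx W) e; rewrite mulmx1 !mulmxA WW => e2.
by rewrite -[RHS]e2 !(mulNmx, mulmxN) mul1mx opprK.
Qed.

Lemma congruence_unit n (W S : 'M[R]_n) :
  W *m W = - 1%:M -> S *m W *m S^T = W -> S \in unitmx.
Proof.
move=> WW SW; have [] // : S \in unitmx /\ (W *m S^T *m (- W)) \in unitmx.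
by apply: mulmx1_unit; rewrite !mulmxA SW mulmxN WW opprK.
Qed.

Lemma congruence_inv n (W S : 'M[R]_n) :
  W *m W = - 1%:M -> S *m W *m S^T = W -> invmx S *m W *m (invmx S)^T = W.
Proof.
move=> WW SW; have Su := congruence_unit WW SW.
by rewrite -{1}SW trmx_inv !mulmxA mulVmx // mul1mx mulmxK // unitmx_tr.
Qed.

(** The inductive construction works with eigenvectors of [A W]; multiplying by [W Y^T] and using
    [Y W Y^T = W] turns that form into the congruence. *)
Lemma williamson_congruence n (A W Y D : 'M[R]_n) : W *m W = - 1%:M ->
  Y^T *m W *m Y = W -> A *m W *m Y = Y *m D *m W -> A = Y *m D *m Y^T.
Proof.
move=> WW YW AY.
have YT : Y *m W *m Y^T = W.
  by have := @congruence_tr _ W Y^T WW; rewrite trmxK => ->.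
have : A *m W *m (Y *m W *m Y^T) = Y *m D *m (W *m W) *m Y^T.
  by rewrite !mulmxA AY.
by rewrite YT -mulmxA WW !mulmxN !mulmx1 mulNmx => /oppr_inj.
Qed.

Lemma rdiagD m n h k : rdiag m n h + rdiag m n k = rdiag m n (fun i => h i + k i).
Proof. by apply/matrixP => i j; rewrite !mxE; case: eqP; rewrite ?addr0. Qed.

Lemma rdiag_inj n h k i : rdiag n n h = rdiag n n k -> (i < n)%N -> h i = k i.
Proof.
by move=> /matrixP e lt_in; have := e (Ordinal lt_in) (Ordinal lt_in);
  rewrite !mxE eqxx.
Qed.

Lemma williamson N (A : 'M[R]_(N.*2)) : A^T = A -> posdef A ->
  exists (Y : 'M[R]_(N.*2)) (nu : nat -> R),
    [/\ Y^T *m Om N.*2 *m Y = Om N.*2, forall i, (i < N)%N -> 0 < nu i &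
        A = Y *m rdiag N.*2 N.*2 (fun i => nu i./2) *m Y^T].
Proof.
move=> AT Ap.
have P0 : rdiag N.*2 N.*2 (fun i => false%:R) = 0.
  by apply/matrixP => i j; rewrite !mxE if_same.
have [||||Y [nu [YY AY _ nu0 _]]] :=
    @williamson_extend R N A (fun=> false) (fun=> 0) 0 AT Ap.
- by rewrite P0 !mulmx0 mul0mx.
- by rewrite mulmx0 !mul0mx.
- by rewrite mul0mx.
- by [].
by exists Y, nu; split=> //; apply: williamson_congruence (Omega_sqr _ N) YY AY.
Qed.

Lemma posdef_mulT n (V : 'M[R]_n) : V \in unitmx -> posdef (V *m V^T).
Proof.
move=> Vu v v0; rewrite mulmxA -mulmxA -trmx_mul.
have : v *m V != 0.
  by apply: contraNneq v0 => vV; rewrite -(mulmxK Vu v) vV mul0mx.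
move: (v *m V) => w /rV0Pn[j wj]; rewrite mxE.
rewrite (bigD1 j) //= mxE ltr_pwDl //; first by rewrite -expr2 exprn_even_gt0.
by apply: sumr_ge0 => i _; rewrite mxE -expr2 sqr_ge0.
Qed.

Lemma posdef_ulsubmx m n (A : 'M[R]_(m + n)) : posdef A -> posdef (ulsubmx A).
Proof.
move=> Ap v v0; have := Ap (row_mx v 0).
rewrite -{1}[A]submxK mul_row_block tr_row_mx mul_row_col !mul0mx !addr0 trmx0.
rewrite mulmx0 addr0; apply; apply: contraNneq v0 => /(congr1 lsubmx).
by rewrite row_mxKl linear0 => ->.
Qed.

Lemma posdef_drsubmx m n (A : 'M[R]_(m + n)) : posdef A -> posdef (drsubmx A).
Proof.
move=> Ap v v0; have := Ap (row_mx 0 v).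
rewrite -{1}[A]submxK mul_row_block tr_row_mx mul_row_col !mul0mx !add0r trmx0.
rewrite mulmx0 add0r; apply; apply: contraNneq v0 => /(congr1 rsubmx).
by rewrite row_mxKr linear0 => ->.
Qed.

End Modewise.

(** * Normal form of a symplectic covariance matrix *)

Section Modewise.
Variable R : realType.
Implicit Types (m n p : nat).
Local Notation Om := (@Omega R).
Local Notation rdiag := (@rdiag R).

Lemma signr_mate i : (-1) ^+ mate i = - (-1) ^+ i :> R.
Proof. by rewrite -signr_odd odd_mate signrN signr_odd. Qed.

(* With [z = e Sg - e] one has [z Sg^-1 z^T = 2 nu - 2], where [Sg^-1] is the
   conjugate of [Sg] by [Om]. *)
Lemma pure_mode N M (Sg : 'M[R]_(N.*2 + M.*2)) (nu : nat -> R) (r : 'I_(N.*2)) :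
  Sg^T = Sg -> posdef Sg ->
  Sg *m Om (N.*2 + M.*2) *m Sg = Om (N.*2 + M.*2) ->
  ulsubmx Sg = rdiag N.*2 N.*2 (fun i => nu i./2) ->
  1 <= nu r./2 /\ (nu r./2 = 1 -> row r (ursubmx Sg) = 0).
Proof.
set W := Om _; set D := rdiag _ _ _ => ST Sp SW ulD.
have WW : W *m W = - 1%:M := Omega_sqr_block _ _ _.
have WT : W^T = - W by exact: tr_Omega.
have Wu : W \in unitmx.
  by have [] // := @mulmx1_unit _ _ W (- W); rewrite mulmxN WW opprK.
pose d : 'rV[R]_(N.*2) := delta_mx 0 r.
pose e : 'rV[R]_(N.*2 + M.*2) := row_mx d 0.
pose z := e *m Sg - e.
have dDd : (d *m D *m d^T) 0 0 = nu r./2.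
  by rewrite trmx_delta -colE -rowE !mxE eqxx.
have eSe : (e *m Sg *m e^T) 0 0 = nu r./2.
  rewrite -[Sg]submxK ulD mul_row_block tr_row_mx mul_row_col !mul0mx !addr0 trmx0.
  by rewrite mulmx0 addr0 dDd.
(* [D] takes one value per mode, so it commutes with [Om] and [Om D Om = - D]. *)
have eWe : (e *m W *m Sg *m W *m e^T) 0 0 = - nu r./2.
  rewrite -[Sg]submxK ulD /W Omega_block !mul_row_block !(mul0mx, mulmx0, addr0, add0r).
  rewrite tr_row_mx mul_row_col trmx0 mulmx0 addr0.
  rewrite -!mulmxA (mulmxA D) rdiag_Omega_comm !mulmxA -(mulmxA d) Omega_sqr.
  by rewrite mulmxN mulmx1 !mulNmx mxE dDd.
have ee : (e *m e^T) 0 0 = 1.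
  rewrite tr_row_mx mul_row_col mul0mx addr0 trmx_delta -colE.
  by rewrite !mxE !eqxx.
have zz : ((z *m W) *m Sg *m (z *m W)^T) 0 0 = nu r./2 *+ 2 - 2.
  rewrite trmx_mul WT mulNmx mulmxN.
  have SWSW : Sg *m W *m Sg *m W = - 1%:M by rewrite SW WW.
  have WSWS : W *m Sg *m W *m Sg = - 1%:M by rewrite -!mulmxA (mulmxA Sg) SW WW.
  have -> : z *m W *m Sg *m (W *m z^T) =
     e *m e^T - e *m Sg *m e^T + (e *m e^T + e *m W *m Sg *m W *m e^T).
    have -> : z^T = Sg *m e^T - e^T by rewrite linearB /= trmx_mul ST.
    have -> : z *m W *m Sg *m (W *m (Sg *m e^T - e^T)) =
      (e *m (Sg *m W *m Sg *m W) - e *m W *m Sg *m W) *m (Sg *m e^T - e^T).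
      by rewrite /z !mulmxBl !mulmxA.
    rewrite SWSW mulmxN mulmx1 mulmxBl; congr (_ + _).
      by rewrite mulNmx mulmxBr opprB mulmxA.
    have -> : e *m W *m Sg *m W *m (Sg *m e^T - e^T) =
      e *m (W *m Sg *m W *m Sg) *m e^T - e *m W *m Sg *m W *m e^T.
      by rewrite mulmxBr !mulmxA.
    by rewrite WSWS mulmxN mulmx1 mulNmx opprB opprK addrC.
  have addE (A B : 'M[R]_1) : (A + B) 0 0 = A 0 0 + B 0 0 by rewrite mxE.
  have oppE (A : 'M[R]_1) : (- A) 0 0 = - A 0 0 by rewrite mxE.
  by rewrite !(addE, oppE) ee eSe eWe; ring.
have zW : z != 0 -> 0 < nu r./2 *+ 2 - 2.
  move=> z0; rewrite -zz; apply: Sp; apply: contraNneq z0 => zW.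
  by rewrite -(mulmxK Wu z) zW mul0mx.
split.
  have [z0|/zW] := eqVneq z 0; last by lra.
  by move: zz; rewrite z0 !mul0mx mxE; lra.
move=> nu1; have : z = 0.
  by apply/eqP; apply: contraT => /zW; rewrite nu1; lra.
move=> /eqP; rewrite subr_eq0 => /eqP/(congr1 rsubmx).
by rewrite -{1}[Sg]submxK mul_row_block !row_mxKr mul0mx addr0 rowE.
Qed.

(** The target blocks are those of [T_G^-1 T_G^-T] with [nu = 2 G - 1]: the coupling is
    [- sqrt (nu^2 - 1)] times [Z], which accounts for the minus sign and for [(-1) ^+ r]. The basis
    [Y] comes from the four block equations of [Sg Om Sg = Om]. *)
Lemma ancilla_normal_form N M (V : 'M[R]_(N.*2 + M.*2)) (nu : nat -> R)
    (Sg := V *m V^T) : (N <= M)%N ->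
  V *m Om (N.*2 + M.*2) *m V^T = Om (N.*2 + M.*2) ->
  ulsubmx Sg = rdiag N.*2 N.*2 (fun i => nu i./2) ->
  (forall i, (i < N)%N -> 1 <= nu i) /\
  exists Y : 'M[R]_(M.*2),
    [/\ Y^T *m Om M.*2 *m Y = Om M.*2,
        ursubmx Sg =
          rdiag N.*2 M.*2 (fun r => - (Num.sqrt (nu r./2 ^+ 2 - 1) * (-1) ^+ r)) *m Y^T &
        drsubmx Sg =
          Y *m rdiag M.*2 M.*2 (fun r => if (r < N.*2)%N then nu r./2 else 1) *m Y^T].
Proof.
move=> NM VW ulD.
have WW := Omega_sqr_block R N M.
have Vu := congruence_unit WW VW.
have Sp : posdef Sg := posdef_mulT Vu.
have ST : Sg^T = Sg by rewrite trmx_mul trmxK.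
have SW : Sg *m Om (N.*2 + M.*2) *m Sg = Om (N.*2 + M.*2).
  by rewrite /Sg -!mulmxA (mulmxA V^T) (mulmxA _ V) (congruence_tr WW VW) mulmxA.
have pure r := @pure_mode N M Sg nu r ST Sp SW ulD.
have nu1 i : (i < N)%N -> 1 <= nu i.
  move=> lti; have lt2 : (i.*2 < N.*2)%N by rewrite ltn_double.
  by have [+ _] := pure (Ordinal lt2); rewrite /= doubleK.
split=> //.
have Bp : posdef (drsubmx Sg) := posdef_drsubmx Sp.
set D := rdiag _ _ _ in ulD.
set C := ursubmx Sg; set B := drsubmx Sg in Bp *.
have SE : Sg = block_mx D C C^T B.
  by rewrite -[LHS]submxK ulD /C trmx_ursub ST.
have BT : B^T = B by rewrite /B trmx_drsub ST.
have DT : D^T = D by rewrite tr_rdiag.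
have /eq_block_mx[E1 E2 _ E4] :
   block_mx (D *m Om N.*2 *m D + C *m Om M.*2 *m C^T)
            (D *m Om N.*2 *m C + C *m Om M.*2 *m B)
            (C^T *m Om N.*2 *m D + B *m Om M.*2 *m C^T)
            (C^T *m Om N.*2 *m C + B *m Om M.*2 *m B) =
   block_mx (Om N.*2) 0 0 (Om M.*2).
  rewrite -[RHS]Omega_block -SW SE Omega_block !mulmx_block.
  by rewrite !(mul0mx, mulmx0, addr0, add0r).
have E3 : B *m Om M.*2 *m C^T = - (C^T *m Om N.*2 *m D).
  apply: trmx_inj; rewrite !linearN /= !trmx_mul !trmxK !tr_Omega BT DT.
  by rewrite !(mulNmx, mulmxN) opprK !mulmxA; apply/eqP; rewrite eq_sym -addr_eq0 E2.
pose ka r : R := Num.sqrt (nu r./2 ^+ 2 - 1).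
have ka2 r : (r < N.*2)%N -> ka r ^+ 2 = nu r./2 ^+ 2 - 1.
  move=> ltr; have /nu1 h : (r./2 < N)%N by lia.
  by rewrite sqr_sqrtr //; nra.
have ka_gt0 r : 1 < nu r./2 -> 0 < ka r.
  by move=> h; rewrite sqrtr_gt0; nra.
(* Rescaling of the columns of [C^T]. Dividing by [ka] compensates [C Om C^T = (1 - nu^2) Om], and
   the alternating sign reverses the orientation, since [1 - nu^2] is negative. The value 0 discards
   the modes with [nu = 1], which [pm] leaves to be completed. *)
pose h r : R := if 1 < nu r./2 then - ((-1) ^+ r / ka r) else 0.
pose k r : R := - (ka r * (-1) ^+ r).
pose pm i := (i < N)%N && (1 < nu i).
have ltNM r : (r < N.*2)%N -> (r < M.*2)%N by lia.
have hmate r : h (mate r) = - h r.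
  by rewrite /h /ka mate_half signr_mate; case: ifP; rewrite ?oppr0 // mulNr.
have sg2 r : (-1) ^+ r * (-1) ^+ r = 1 :> R.
  by rewrite -signr_odd; case: odd; rewrite /=; ring.
pose X0 := C^T *m rdiag N.*2 M.*2 h.
have CC : C *m Om M.*2 *m C^T = rdiag N.*2 N.*2 (fun r => 1 - nu r./2 ^+ 2) *m Om N.*2.
  rewrite (canRL (addKr _) E1) -(mulmxA D) -rdiag_Omega_comm mulmxA rdiagM.
  have -> : rdiag N.*2 N.*2 (fun r => 1 - nu r./2 ^+ 2) =
      1%:M - rdiag N.*2 N.*2 (fun r => nu r./2 ^+ 2).
    by apply/matrixP => i j; rewrite !mxE -val_eqE; case: eqP; rewrite ?subr0.
  rewrite mulmxBl mul1mx addrC; congr (_ - _ *m _).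
  by apply: eq_rdiag => r -> _; rewrite expr2.
have leNM : (N.*2 <= M.*2)%N by rewrite leq_double.
have hk r : (r < N.*2)%N -> h r * k r = (1 < nu r./2)%R%:R.
  move=> ltr; rewrite /h /k; case: ifP => [/ka_gt0 ka0|]; last by rewrite mul0r.
  rewrite mulrNN (_ : _ / _ * _ = (-1) ^+ r * (-1) ^+ r * (ka r / ka r)); last by ring.
  by rewrite sg2 divff ?mulr1 // gt_eqF.
have hh r : (r < N.*2)%N -> h r * (1 - nu r./2 ^+ 2) * h r = - (1 < nu r./2)%R%:R.
  move=> ltr; rewrite -(opprB _ 1) -ka2 // /h.
  case: ifP => [/ka_gt0 ka0|]; last by rewrite mulr0 oppr0.
  rewrite (_ : _ * _ * _ = - ((-1) ^+ r * (-1) ^+ r * (ka r / ka r) ^+ 2)); last by ring.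
  by rewrite sg2 divff ?expr1n ?mulr1 // gt_eqF.
have [||||Y [nu' [YY BY YP nu'0 _]]] := @williamson_extend R M B pm nu X0 BT Bp.
- rewrite /X0 trmx_mul trmxK tr_rdiag -!mulmxA (mulmxA _ C^T) !(mulmxA C) CC.
  rewrite -mulmxA -[Om _ *m rdiag _ _ _]opprK -(rdiag_Omega_anti NM); last by move=> *.
  rewrite !mulmxN !mulmxA !rdiagM -mulNmx; congr (_ *m _).
  apply/matrixP => i j; rewrite !mxE; case: eqP => [_|]; last by rewrite oppr0.
  rewrite /pm; case: (ltnP i N.*2) => hi; last first.
    by rewrite ?mul0r oppr0 (_ : (i./2 < N)%N = false) //; lia.
  by rewrite hh // opprK (_ : (i./2 < N)%N) //; lia.
- rewrite /X0 mulmxA E3 -!mulmxA mulNmx -!mulmxA !rdiagM.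
  rewrite (mulmxA (rdiag _ _ h)) rdiagM -mulmxN; congr (_ *m _).
  rewrite (_ : rdiag _ _ (fun i => if _ then _ * nu _ else _) =
    rdiag N.*2 M.*2 (fun i => nu i./2 * h i)); last first.
    by apply: eq_rdiag => r ltr ->; rewrite mulrC.
  rewrite (rdiag_Omega_anti NM) => [|r _]; last by rewrite hmate mate_half mulrN.
  by congr (- (_ *m _)); apply: eq_rdiag => r -> _.
- rewrite /X0 -mulmxA rdiagM; congr (_ *m _); apply: eq_rdiag => r ltr ->.
  rewrite /pm (_ : (r./2 < N)%N) /=; last by lia.
  by rewrite /h; case: ifP; rewrite ?mulr1 ?mulr0.
- by move=> i /andP[_]; apply: le_lt_trans; exact: ler01.
exists Y.
have BE := williamson_congruence (Omega_sqr _ M) YY BY.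
(* On coupled modes [h] and [k] are inverse to each other, so the prescribed columns of [Y] give
   back [C^T]. On modes with [nu = 1], [k] vanishes and so do the rows of [C], by [pure]. *)
have CE : C^T = Y *m rdiag M.*2 N.*2 k.
  have -> : rdiag M.*2 N.*2 k =
      rdiag M.*2 M.*2 (fun i => (pm i./2)%:R) *m rdiag M.*2 N.*2 k.
    rewrite rdiagM; apply: eq_rdiag => r -> ltr; have r2 : (r./2 < N)%N by lia.
    rewrite /pm r2 /=; have := nu1 _ r2; rewrite le_eqVlt => /orP[/eqP e|->].
      by rewrite /k /ka -e expr1n subrr sqrtr0 mul0r oppr0 mulr0.
    by rewrite mul1r.
  rewrite mulmxA YP /X0 -mulmxA rdiagM.
  apply: trmx_inj; rewrite trmxK trmx_mul trmxK tr_rdiag.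
  apply/matrixP => i j; rewrite mul_rdiag_mxE.
  case: {-}_ / idP => [ltr|]; last by rewrite ltn_ord.
  rewrite ltNM // hk //.
  have -> : Ordinal ltr = i by apply: val_inj.
  have i2 : (i./2 < N)%N by have := ltn_ord i; lia.
  have := nu1 _ i2; rewrite le_eqVlt => /orP[/eqP e|->]; last by rewrite mul1r.
  have [_ /(_ (esym e))/rowP/(_ j)] := pure i.
  by rewrite mxE [RHS]mxE -e ltxx mul0r => ->.
have CE' : C = rdiag N.*2 M.*2 k *m Y^T by rewrite -[LHS]trmxK CE trmx_mul tr_rdiag.
split=> //.
(* Completion leaves the eigenvalues outside [pm] undetermined. Equation [E4] in the basis [Y] reads
   [nu'^2 = 1 + k^2], that is [nu^2] on the first N modes and 1 on the others, and positivity
   selects the root. *)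
suff -> : rdiag M.*2 M.*2 (fun r => if (r < N.*2)%N then nu r./2 else 1) =
   rdiag M.*2 M.*2 (fun i => nu' i./2) by [].
have Yu : Y^T \in unitmx by apply: (congruence_unit (Omega_sqr _ M)); rewrite trmxK.
have YT : Y *m Om M.*2 *m Y^T = Om M.*2.
  by have := @congruence_tr _ _ _ Y^T (Omega_sqr _ M); rewrite trmxK => ->.
set D' := rdiag _ _ (fun i => nu' i./2) in BE *.
have key : rdiag M.*2 N.*2 k *m Om N.*2 *m rdiag N.*2 M.*2 k + D' *m Om M.*2 *m D' = Om M.*2.
  have Yu' : Y \in unitmx by rewrite -unitmx_tr.
  apply: (can_inj (mulKmx Yu')).
  apply: (can_inj (mulmxK Yu)); rewrite YT -[RHS]E4 CE CE' BE mulmxDr mulmxDl.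
  congr (_ + _); first by rewrite !mulmxA.
  by rewrite -[in LHS]YY !mulmxA.
move: key; rewrite -(mulmxA (rdiag _ _ k)) -[Om N.*2 *m _]opprK
  -(rdiag_Omega_anti NM); last first.
  by move=> r _; rewrite /k /ka mate_half signr_mate mulrN opprK.
rewrite mulmxN mulmxA rdiagM -mulmxA -rdiag_Omega_comm mulmxA rdiagM => key.
have {}key : rdiag M.*2 M.*2 (fun r => nu' r./2 * nu' r./2) =
    1%:M + rdiag M.*2 M.*2 (fun r => if (r < N.*2)%N then k r * k r else 0).
  apply: (can_inj (mulmxK (Omega_unit R M))); rewrite mulmxDl mul1mx.
  rewrite -[X in _ = X + _]key addrAC addNr add0r; congr (_ *m _).
  by apply: eq_rdiag => r -> _.
apply: eq_rdiag => r ltr _; have := nu'0 r./2; have -> : (r./2 < M)%N by lia.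
move=> /(_ isT) nu'r.
move: key; rewrite -(@rdiag1 _ _ (fun=> 1)) // rdiagD => /rdiag_inj/(_ ltr) /=.
case: ifP => hr; last by move=> e; nra.
have r2 : (r./2 < N)%N by lia.
have := nu1 _ r2; rewrite /k mulrNN mulrACA sg2 mulr1 -(expr2 (ka r)) ka2 // => h1 e.
nra.
Qed.
End Modewise.

(** * Two-mode squeezing and the modewise decomposition *)

Section Modewise.
Variable R : realType.
Implicit Types (m n p : nat).
Local Notation Om := (@Omega R).
Local Notation rdiag := (@rdiag R).

Lemma TMS_encE N M (G : nat -> R) :
  TMS_enc N M G = block_mx
    (rdiag N.*2 N.*2 (fun r => Num.sqrt (G r./2)))
    (rdiag N.*2 M.*2 (fun r => Num.sqrt (G r./2 - 1) * (-1) ^+ r))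
    (rdiag M.*2 N.*2 (fun r => Num.sqrt (G r./2 - 1) * (-1) ^+ r))
    (rdiag M.*2 M.*2 (fun r => if (r < N.*2)%N then Num.sqrt (G r./2) else 1)).
Proof.
by congr block_mx; apply/matrixP => i j; rewrite !mxE //; case: eqP => // ->.
Qed.

(** Hyperbolic double-angle formulas: with [a = sqrt G] and [b = sqrt (G - 1)] one has
    [a^2 - b^2 = 1], [nu = a^2 + b^2] and [sqrt (nu^2 - 1) = 2 a b]. In each coupled mode the
    diagonal entries become [(a^2 - b^2)^2] and the coupling entries cancel. *)
Lemma TMS_orthogonal N M (nu : nat -> R)
    (G := fun i => (nu i + 1) / 2)
    (k := fun r : nat => - (Num.sqrt (nu r./2 ^+ 2 - 1) * (-1) ^+ r)) :
  (N <= M)%N -> (forall i, (i < N)%N -> 1 <= nu i) ->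
  TMS_enc N M G *m block_mx
      (rdiag N.*2 N.*2 (fun i => nu i./2)) (rdiag N.*2 M.*2 k) (rdiag M.*2 N.*2 k)
      (rdiag M.*2 M.*2 (fun r => if (r < N.*2)%N then nu r./2 else 1))
    *m (TMS_enc N M G)^T = 1%:M.
Proof.
move=> NM nu1.
rewrite TMS_encE tr_block_mx !tr_rdiag !mulmx_block !rdiagM !rdiagD !rdiagM !rdiagD.
rewrite (scalar_mx_block N.*2 M.*2).
pose a r := Num.sqrt (G r./2); pose b r := Num.sqrt (G r./2 - 1).
have sg r : (-1) ^+ r = 1 :> R \/ (-1) ^+ r = -1 :> R.
  by rewrite -signr_odd; case: odd; [right|left].
have rdiag0 m n h : (forall i, (i < m)%N -> (i < n)%N -> h i = 0) -> rdiag m n h = 0.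
  by move=> /eq_rdiag ->; apply/matrixP => i j; rewrite !mxE if_same.
have ltNM r : (r < N.*2)%N -> (r < M.*2)%N by lia.
have abE r : (r < N.*2)%N ->
    [/\ a r ^+ 2 - b r ^+ 2 = 1, nu r./2 = a r ^+ 2 + b r ^+ 2 &
        Num.sqrt (nu r./2 ^+ 2 - 1) = 2 * a r * b r].
  move=> hr; have /nu1 h : (r./2 < N)%N by lia.
  have a2 : a r ^+ 2 = G r./2 by rewrite sqr_sqrtr // /G; lra.
  have b2 : b r ^+ 2 = G r./2 - 1 by rewrite sqr_sqrtr // /G; lra.
  rewrite a2 b2; split; rewrite /G; try lra.
  have -> : nu r./2 ^+ 2 - 1 = (2 * a r * b r) ^+ 2.
    by rewrite !exprMn a2 b2 /G; field.
  by rewrite sqrtr_sqr ger0_norm // !mulr_ge0 // sqrtr_ge0.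
have one x y : x ^+ 2 - y ^+ 2 = 1 :> R -> (x ^+ 2 - y ^+ 2) ^+ 2 = 1.
  by move=> ->; rewrite expr1n.
congr block_mx.
- apply: rdiag1 => r hr; rewrite hr ltNM // /k -/(a r) -/(b r).
  have [/one e -> ->] := abE r hr; rewrite -[RHS]e; case: (sg r) => ->; ring.
- apply: rdiag0 => r hr hr'; rewrite hr hr' /k -/(a r) -/(b r).
  have [_ -> ->] := abE r hr; case: (sg r) => ->; ring.
- apply: rdiag0 => r hr' hr; rewrite hr hr' /k -/(a r) -/(b r).
  have [_ -> ->] := abE r hr; case: (sg r) => ->; ring.
- apply: rdiag1 => r hr'; rewrite hr'; case: ltnP => hr; last by rewrite !add0r !mulr1.
  rewrite /k -/(a r) -/(b r).
  have [/one e -> ->] := abE r hr; rewrite -[RHS]e; case: (sg r) => ->; ring.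
Qed.

Lemma modewise_decomposition N M (Senc : 'M[R]_(N.*2 + M.*2)) : (N <= M)%N ->
  symplectic Senc ->
  exists (G : nat -> R) (Sd : 'M[R]_(N.*2)) (Sa : 'M[R]_(M.*2)),
    let O := TMS_enc N M G *m block_mx Sd 0 0 Sa *m invmx Senc in
    [/\ forall i, (i < N)%N -> 1 <= G i, symplectic Sd, symplectic Sa,
        TMS_enc N M G \in unitmx & O *m O^T = 1%:M].
Proof.
move=> NM SS; have WW := Omega_sqr_block R N M.
pose V := invmx Senc; have VW : V *m Om _ *m V^T = Om _ := congruence_inv WW SS.
have Vu := congruence_unit WW VW.
have ST : (V *m V^T)^T = V *m V^T by rewrite trmx_mul trmxK.
have [||Y [nu [YY _ AE]]] := @williamson R N (ulsubmx (V *m V^T)).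
- by rewrite trmx_ulsub ST.
- exact/posdef_ulsubmx/posdef_mulT.
have inv_sympl n (Z : 'M[R]_(n.*2)) : Z^T *m Om n.*2 *m Z = Om n.*2 ->
    Z \in unitmx /\ symplectic (invmx Z).
  move=> ZZ; have ZW : Z *m Om n.*2 *m Z^T = Om n.*2.
    by have := @congruence_tr R _ _ Z^T (Omega_sqr _ n); rewrite trmxK => ->.
  split; first exact: congruence_unit (Omega_sqr _ n) ZW.
  exact: congruence_inv (Omega_sqr _ n) ZW.
have [Yu YS] := inv_sympl _ _ YY.
pose V1 := block_mx (invmx Y) 0 0 1%:M *m V.
have V1W : V1 *m Om (N.*2 + M.*2) *m V1^T = Om (N.*2 + M.*2).
  rewrite trmx_mul -!mulmxA (mulmxA (Om _)) (mulmxA V) (mulmxA V) VW.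
  rewrite Omega_block tr_block_mx !mulmx_block !trmx0 trmx1.
  by rewrite !(mul0mx, mulmx0, addr0, add0r, mul1mx, mulmx1) mulmxA YS.
have V1T : (V1 *m V1^T)^T = V1 *m V1^T by rewrite trmx_mul trmxK.
have V1E : V1 *m V1^T =
    block_mx (invmx Y) 0 0 1%:M *m (V *m V^T) *m block_mx (invmx Y)^T 0 0 1%:M.
  by rewrite trmx_mul tr_block_mx !trmx0 trmx1 !mulmxA.
have DE : ulsubmx (V1 *m V1^T) = rdiag N.*2 N.*2 (fun i => nu i./2).
  rewrite V1E -[V *m V^T]submxK AE !mulmx_block block_mxKul.
  rewrite !(mul0mx, mulmx0, addr0, add0r, mul1mx, mulmx1).
  by rewrite !mulmxA mulVmx // mul1mx trmx_inv mulmxK // unitmx_tr.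
have [nu1 [Z [ZZ CE BE]]] := ancilla_normal_form NM V1W DE.
have [Zu ZS] := inv_sympl _ _ ZZ.
(* The diagonal entry of [T_G^-1 T_G^-T] is [G + (G - 1)], which has to equal [nu]. *)
pose G i := (nu i + 1) / 2.
have TT := @TMS_orthogonal N M nu NM nu1.
exists G, (invmx Y), (invmx Z); split=> //.
- by move=> i /nu1; rewrite /G; lra.
- by move: TT; rewrite -mulmxA => /mulmx1_unit[].
rewrite -/V -(mulmxA (TMS_enc N M G)).
have -> : block_mx (invmx Y) 0 0 (invmx Z) *m V = block_mx 1%:M 0 0 (invmx Z) *m V1.
  rewrite /V1 mulmxA mulmx_block.
  by rewrite !(mul0mx, mulmx0, addr0, add0r, mul1mx, mulmx1).
rewrite trmx_mul -[RHS]TT -!mulmxA; congr (_ *m _); rewrite !mulmxA; congr (_ *m _).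
have ZTu : Z^T \in unitmx by rewrite unitmx_tr.
rewrite -(mulmxA _ _ V) -/V1 trmx_mul mulmxA -(mulmxA _ V1) -[V1 *m V1^T]submxK DE CE BE.
rewrite -[dlsubmx _]trmxK trmx_dlsub V1T CE trmx_mul trmxK tr_rdiag.
rewrite tr_block_mx !trmx0 trmx1 !mulmx_block.
rewrite !(mul0mx, mulmx0, addr0, add0r, mul1mx, mulmx1) trmx_inv.
by congr block_mx; rewrite ?mulmxA ?mulVmx ?mul1mx ?mulmxK.
Qed.
End Modewise.

(** * Rotation invariance of Gaussian noise *)

Section Plane.
Variable R : realType.
Local Notation mu := (@lebesgue_measure R).
Local Open Scope ereal_scope.

Lemma lebesgue_measure_shift (a : R) (A : set R) : measurable A ->
  pushforward mu ((fun x => x + a)%R : _ -> measurableTypeR R) A = mu A.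
Proof.
have ms : measurable_fun [set: measurableTypeR R]
    ((fun x => x + a)%R : measurableTypeR R -> measurableTypeR R).
  by apply: measurable_funD.
move=> mA; apply/esym/lebesgue_measure_unique => //= _ [[x y]] _ <-.
rewrite /pushforward.
have -> : (fun z : R => z + a)%R @^-1` `]x, y]%classic = `](x - a)%R, (y - a)%R]%classic.
  by apply/seteqP; split => z /=; rewrite !in_itv /= ltrBlDr lerBrDr.
rewrite !lebesgue_measure_itv/= !lte_fin ltrD2r; case: ifP => // _.
by rewrite -!EFinB; congr EFin; ring.
Qed.

Lemma ge0_integral_shift (a : R) (f : R -> \bar R) :
  measurable_fun [set: R] f -> (forall x, 0 <= f x) ->
  \int[mu]_x f (x + a)%R = \int[mu]_x f x.
Proof.
move=> mf f0.
have ms : measurable_fun [set: measurableTypeR R]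
    ((fun x => x + a)%R : measurableTypeR R -> measurableTypeR R).
  by apply: measurable_funD.
rewrite -[LHS](@ge0_integral_pushforward _ _ _ _ R _ ms mu setT f) //.
by apply: eq_measure_integral => //= A mA _; exact: lebesgue_measure_shift.
Qed.

(** For a fixed second coordinate the shear is a translation, so the inner Tonelli integral does not
    change. *)
Lemma ge0_integral_shear1 (t : R) (g : R * R -> \bar R) :
  measurable_fun [set: R * R] g -> (forall z, 0 <= g z) ->
  \int[mu \x mu]_z g (z.1 + t * z.2, z.2)%R = \int[mu \x mu]_z g z.
Proof.
move=> mg g0.
have ms : measurable_fun [set: R * R] (fun z : R * R => (z.1 + t * z.2, z.2)%R).
  apply/measurable_fun_pair => //=; apply: measurable_funD => //.
  by apply: measurable_funM.
rewrite fubini_tonelli2 //; last exact: measurableT_comp.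
rewrite fubini_tonelli2 //; apply: eq_integral => y _; rewrite /fubini_G /=.
rewrite (ge0_integral_shift (t * y) (f := fun x => g (x, y))) //.
exact: measurableT_comp.
Qed.

Lemma ge0_integral_shear2 (t : R) (g : R * R -> \bar R) :
  measurable_fun [set: R * R] g -> (forall z, 0 <= g z) ->
  \int[mu \x mu]_z g (z.1, z.2 + t * z.1)%R = \int[mu \x mu]_z g z.
Proof.
move=> mg g0.
have ms : measurable_fun [set: R * R] (fun z : R * R => (z.1, z.2 + t * z.1)%R).
  apply/measurable_fun_pair => //=; apply: measurable_funD => //.
  by apply: measurable_funM.
rewrite fubini_tonelli1 //; last exact: measurableT_comp.
rewrite fubini_tonelli1 //; apply: eq_integral => x _; rewrite /fubini_F /=.
rewrite (ge0_integral_shift (t * x) (f := fun y => g (x, y))) //.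
exact: measurableT_comp.
Qed.

Definition rotation (c s : R) (z : R * R) : R * R :=
  (c * z.1 - s * z.2, s * z.1 + c * z.2)%R.

Lemma measurable_rotation c s : measurable_fun [set: R * R] (rotation c s).
Proof.
apply/measurable_fun_pair => /=.
  by apply: measurable_funB; apply: measurable_funM.
by apply: measurable_funD; apply: measurable_funM.
Qed.

(* A rotation of angle not in [pi Z] is a product of three shears. *)
Lemma ge0_integral_rotation (c s : R) (g : R * R -> \bar R) :
  (c ^+ 2 + s ^+ 2 = 1)%R -> s != 0%R ->
  measurable_fun [set: R * R] g -> (forall z, 0 <= g z) ->
  \int[mu \x mu]_z g (rotation c s z) = \int[mu \x mu]_z g z.
Proof.
(* For a rotation of angle [theta] this is [- tan (theta / 2)]; [ts] and [tc] are the half-angle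
   identities for the composite of the shears [t], [s], [t]. *)
move=> cs s0 mg g0; pose t := ((c - 1) / s)%R.
have m1 (h : R * R -> \bar R) : measurable_fun [set: R * R] h ->
    measurable_fun [set: R * R] (fun z => h (z.1 + t * z.2, z.2)%R).
  move=> mh; apply: (measurableT_comp mh).
  apply/measurable_fun_pair => //=; apply: measurable_funD => //.
  by apply: measurable_funM.
have m2 (h : R * R -> \bar R) : measurable_fun [set: R * R] h ->
    measurable_fun [set: R * R] (fun z => h (z.1, z.2 + s * z.1)%R).
  move=> mh; apply: (measurableT_comp mh).
  apply/measurable_fun_pair => //=; apply: measurable_funD => //.
  by apply: measurable_funM.
rewrite -[RHS](ge0_integral_shear1 t) //.
rewrite -[RHS](ge0_integral_shear2 s) //; last exact: (m1 _ mg).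
rewrite -[RHS](ge0_integral_shear1 t) //; last exact: (m2 _ (m1 _ mg)).
have ts : (t * s = c - 1)%R by rewrite divfK.
have tc : (t * (2 + (c - 1)) = - s)%R.
  apply: (mulIf s0); rewrite mulrAC ts mulNr -expr2.
  by rewrite (_ : s ^+ 2 = 1 - c ^+ 2)%R; [ring | rewrite -cs; ring].
apply: eq_integral => -[x y] _ /=; congr g; congr pair.
  rewrite [RHS](_ : _ = (1 + t * s) * x + t * (2 + t * s) * y)%R; last by ring.
  by rewrite ts tc /=; ring.
by rewrite [RHS](_ : _ = s * x + (1 + t * s) * y)%R; [rewrite ts /=; ring | ring].
Qed.

(** * The planar Gaussian measure *)

Section Gauss.
Variable sigma : R.
Hypothesis sigma0 : (0 < sigma)%R.
Local Notation p := (normal_pdf 0 sigma).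

(** Defined by its density, because rotation invariance is visible there: [p x * p y] depends only
    on [x^2 + y^2]. *)
Definition gauss_plane (B : set (R * R)) : \bar R :=
  \int[mu \x mu]_(z in B) (p z.1 * p z.2)%:E.

Let p2_ge0 (z : R * R) : 0 <= (p z.1 * p z.2)%:E.
Proof. by rewrite lee_fin mulr_ge0 // normal_pdf_ge0. Qed.

Let measurable_p2 : measurable_fun [set: R * R] (fun z : R * R => (p z.1 * p z.2)%:E).
Proof.
apply/measurable_EFinP; apply: measurable_funM;
  by apply: (measurableT_comp (measurable_normal_pdf _ _)).
Qed.

Let gauss_plane0 : gauss_plane set0 = 0.
Proof. by rewrite /gauss_plane integral_set0. Qed.

Let gauss_plane_ge0 A : 0 <= gauss_plane A.
Proof. exact: integral_ge0. Qed.

Let gauss_plane_sigma_additive : semi_sigma_additive gauss_plane.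
Proof.
move=> /= A mA tA mUA; rewrite /gauss_plane ge0_integral_bigcup //=.
  by apply: is_cvg_ereal_nneg_natsum_cond => n _ _; exact: integral_ge0.
exact: measurable_funTS.
Qed.

HB.instance Definition _ := isMeasure.Build _ _ _
  gauss_plane gauss_plane0 gauss_plane_ge0 gauss_plane_sigma_additive.

Lemma gauss_planeX (A B : set R) : measurable A -> measurable B ->
  gauss_plane (A `*` B) = normal_prob 0 sigma A * normal_prob 0 sigma B.
Proof.
move=> mA mB; rewrite /gauss_plane integral_mkcond.
pose q (D : set R) : R -> \bar R := (fun x => (p x)%:E) \_ D.
have mp : measurable_fun [set: R] (fun x : R => (p x)%:E).
  by apply/measurable_EFinP; exact: measurable_normal_pdf.
have mq (D : set R) : measurable D -> measurable_fun [set: R] (q D).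
  by move=> mD; apply/(measurable_restrictT _ _).1 => //; exact: measurable_funTS.
have q0 (D : set R) x : 0 <= q D x.
  by rewrite /q patchE; case: ifP => // _; rewrite lee_fin normal_pdf_ge0.
have -> : (fun z : R * R => (p z.1 * p z.2)%:E) \_ (A `*` B) =
    (fun z => q A z.1 * q B z.2).
  apply/funext => -[x y]; rewrite /q !patchE /= in_setX /=.
  by case: (x \in A); case: (y \in B); rewrite /= ?mule0 ?mul0e ?EFinM.
rewrite fubini_tonelli1; last 2 first.
- apply: emeasurable_funM; first exact: (measurableT_comp (mq _ mA)).
  exact: (measurableT_comp (mq _ mB)).
- by move=> z; apply: mule_ge0.
transitivity (\int[mu]_x (q A x * normal_prob 0 sigma B)).
  apply: eq_integral => x _; rewrite /fubini_F /= ge0_integralZl //; last exact: mq.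
  by rewrite /normal_prob [in RHS]integral_mkcond.
rewrite ge0_integralZr //; last exact: mq.
by congr (_ * _); rewrite /normal_prob [in RHS]integral_mkcond.
Qed.

Lemma gauss_plane_rotation c s (B : set (R * R)) :
  (c ^+ 2 + s ^+ 2 = 1)%R -> s != 0%R -> measurable B ->
  gauss_plane (rotation c s @^-1` B) = gauss_plane B.
Proof.
move=> cs s0 mB; rewrite /gauss_plane [LHS]integral_mkcond [RHS]integral_mkcond.
set g := _ \_ B; rewrite -[RHS](@ge0_integral_rotation c s g cs s0).
- apply: eq_integral => z _; rewrite /g !patchE.
  have -> : (z \in rotation c s @^-1` B) = (rotation c s z \in B).
    by apply/idP/idP; rewrite !inE.
  case: ifP => // _; congr EFin; rewrite !normal_pdfE ?gt_eqF //.
  rewrite mulrACA [RHS]mulrACA; congr (_ * _)%R.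
  rewrite /normal_fun -!expRD; congr expR; rewrite !subr0 -!mulrDl -!opprD.
  congr (- _ * _)%R; rewrite /rotation /=.
  transitivity ((c ^+ 2 + s ^+ 2) * (z.1 ^+ 2 + z.2 ^+ 2))%R; last by ring.
  by rewrite cs mul1r.
- by apply/(measurable_restrictT _ _).1 => //; exact: measurable_funTS.
- by move=> z; rewrite /g patchE; case: ifP.
Qed.
End Gauss.
End Plane.

(** * Uniqueness on rectangles, and symmetry of the normal law *)

Section Rect.
Variable R : realType.
Local Open Scope ereal_scope.

Lemma plane_measure_unique (m1 m2 : {measure set (R * R) -> \bar R}) :
  m1 setT < +oo ->
  (forall A B, measurable A -> measurable B -> m1 (A `*` B) = m2 (A `*` B)) ->
  forall X : set (R * R), measurable X -> m1 X = m2 X.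
Proof.
move=> m1T m12.
pose C : set (set (R * R)) :=
  [set C | exists A, measurable A /\ exists B, measurable B /\ C = A `*` B].
have CI : setI_closed C.
  move=> /= _ _ [X1 [mX1 [X2 [mX2 ->]]]] [Y1 [mY1 [Y2 [mY2 ->]]]].
  rewrite -setXI; exists (X1 `&` Y1); split; first exact: measurableI.
  by exists (X2 `&` Y2); split => //; exact: measurableI.
move=> X mX; apply: (measure_unique C (fun=> setT)) => //.
- rewrite measurable_prod_measurableType //; congr (<<s _ >>).
  rewrite predeqE; split => [[A mA [B mB <-]]|[A [mA [B [mB ->]]]]].
    by exists A; split => //; exists B.
  by exists A => //; exists B.
- move=> n; exists setT; split => //; exists setT; split => //.
  by rewrite setXTT.
- by rewrite bigcup_const.
- by move=> A [A1 [mA1 [A2 [mA2 ->]]]]; exact: m12.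
Qed.

Lemma normal_probN (sigma : R) (A : set R) : (0 < sigma)%R -> measurable A ->
  normal_prob 0 sigma ((-%R : R -> R) @^-1` A) = normal_prob 0 sigma A.
Proof.
move=> s0 mA; rewrite /normal_prob.
transitivity (\int[lebesgue_measure]_(x in (-%R : R -> R) @^-1` A)
   (EFin \o normal_pdf 0 sigma \o -%R) x).
  apply: eq_integral => x _ /=; congr EFin.
  by rewrite !normal_pdfE ?gt_eqF // /normal_fun !subr0 sqrrN.
rewrite -(@ge0_integral_pushforward _ _ _ _ R
  (-%R : measurableTypeR R -> measurableTypeR R)) //=.
- by apply: eq_measure_integral => //= B mB _; exact: lebesgue_measureN.
- apply: measurable_funTS; apply/measurable_EFinP; exact: measurable_normal_pdf.
- by move=> x _ /=; rewrite lee_fin normal_pdf_ge0.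
Qed.

End Rect.

(** * Noise under sign flips and plane rotations *)

Section Iid.
Variables (R : realType) (d : measure_display) (T : measurableType d).
Variables (P : probability T R) (k : nat) (sigma : R).
Hypothesis sigma0 : 0 < sigma.
Implicit Types (xi : T -> 'cV[R]_k).
Local Notation nrm := (normal_prob 0 sigma).

(** Marginals and independence merge into one product formula on boxes; a marginal is recovered from
    a box that is full in every other coordinate. *)
Lemma iid_gaussianP xi : iid_gaussian_noise P sigma xi <->
  (forall i : 'I_k, measurable_fun [set: T] (fun w => xi w i ord0)) /\
  (forall A : 'I_k -> set R, (forall i, measurable (A i)) ->
      P (\bigcap_i ((fun w => xi w i ord0) @^-1` A i)) =
      (\prod_(i < k) nrm (A i))%E).
Proof.
split=> [[mxi [mar ind]]|[mxi ind]].
  by split=> // A mA; rewrite ind //; apply: eq_bigr => i _; exact: mar.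
have mar (i : 'I_k) (A : set R) : measurable A ->
    P ((fun w => xi w i ord0) @^-1` A) = nrm A.
  move=> mA; pose B j := if j == i then A else setT.
  have := ind B; rewrite (bigD1 i) //= big1 ?mule1; last first.
    by move=> j ji; rewrite /B (negbTE ji); exact: probability_setT.
  rewrite /B eqxx => <-; last by move=> j; case: ifP.
  congr (P _); apply/seteqP; split=> w /=.
    by move=> Aw j _; case: eqP => // ->.
  by move=> /(_ i Logic.I); rewrite eqxx.
split=> //; split=> // A mA.
by rewrite ind //; apply: eq_bigr => i _; rewrite mar.
Qed.

Lemma iid_gaussian_flip xi (i : 'I_k) : iid_gaussian_noise P sigma xi ->
  iid_gaussian_noise P sigma
    (fun w => diag_mx (\row_j (if j == i then -1 else 1)) *m xi w).
Proof.
move=> /iid_gaussianP[mxi ind]; apply/iid_gaussianP.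
have E j w : (diag_mx (\row_j0 (if j0 == i then -1 else 1)) *m xi w) j ord0 =
    if j == i then - xi w j ord0 else xi w j ord0.
  rewrite mul_diag_mx !mxE; case: ifP => _; by rewrite ?mulN1r ?mul1r.
split=> [j|A mA].
  rewrite [X in measurable_fun _ X](_ : _ =
    (fun w => if j == i then - xi w j ord0 else xi w j ord0)); last first.
    by apply/funext => w; rewrite E.
  by case: (j == i) => //; exact: measurable_funN.
pose B j := if j == i then (-%R : R -> R) @^-1` A j else A j.
transitivity (P (\bigcap_j ((fun w => xi w j ord0) @^-1` B j))).
  congr (P _); apply: eq_bigcapr => j _; apply/seteqP.
  by split=> w /=; rewrite E /B; case: ifP.
rewrite ind; last first.
  move=> j; rewrite /B; case: ifP => // _; rewrite -[X in measurable X]setTI.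
  exact: oppr_measurable.
by apply: eq_bigr => j _; rewrite /B; case: ifP => // _; exact: normal_probN.
Qed.

(** Matrix counterpart of [rotation c s] in the plane of coordinates [i] and [j]. *)
Definition givens (i j : 'I_k) (c s : R) : 'M[R]_k :=
  \matrix_(a, b) if a == i then c *+ (b == i) - s *+ (b == j)
                 else if a == j then s *+ (b == i) + c *+ (b == j)
                 else (a == b)%:R.

Lemma mul_givensE n i j c s (X : 'M[R]_(k, n)) a b :
  (givens i j c s *m X) a b =
    if a == i then c * X i b - s * X j b
    else if a == j then s * X i b + c * X j b else X a b.
Proof.
have pick (x : R) l : \sum_(r < k) (x *+ (r == l)) * X r b = x * X l b.
  rewrite (bigD1 l) //= eqxx big1 ?addr0 // => r /negbTE ->.
  by rewrite mul0r.
rewrite mxE; case: ifP => ai; [|case: ifP => aj].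
- rewrite -!pick -sumrB; apply: eq_bigr => r _.
  by rewrite mxE ai mulrBl.
- rewrite -!pick -big_split; apply: eq_bigr => r _.
  by rewrite mxE ai aj mulrDl.
- rewrite -[RHS]mul1r -pick; apply: eq_bigr => r _.
  by rewrite mxE ai aj eq_sym.
Qed.

(** Confining the other coordinates to their box (event [E]) leaves a finite measure on the plane of
    coordinates [i], [j]. On rectangles it is [P E] times [gauss_plane], hence on all measurable
    sets, including the rotated rectangle, which is no longer a product. *)
Lemma iid_gaussian_givens xi (i j : 'I_k) (c s : R) : i != j ->
  c ^+ 2 + s ^+ 2 = 1 -> s != 0 -> iid_gaussian_noise P sigma xi ->
  iid_gaussian_noise P sigma (fun w => givens i j c s *m xi w).
Proof.
move=> ij cs s0 /iid_gaussianP[mxi ind]; apply/iid_gaussianP.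
have ji : (j == i) = false by rewrite eq_sym; exact: negbTE.
split=> [a|A mA].
  rewrite [X in measurable_fun _ X](_ : _ = (fun w =>
    if a == i then c * xi w i ord0 - s * xi w j ord0
    else if a == j then s * xi w i ord0 + c * xi w j ord0 else xi w a ord0)); last first.
    by apply/funext => w; rewrite mul_givensE.
  case: (a == i); first by apply: measurable_funB; apply: measurable_funM.
  by case: (a == j) => //; apply: measurable_funD; apply: measurable_funM.
pose E := \bigcap_(a in [set a | (a != i) && (a != j)]) ((fun w => xi w a ord0) @^-1` A a).
have mE : measurable E.
  apply: fin_bigcap_measurable; first exact: finite_finset.
  by move=> a _; rewrite -[X in measurable X]setTI; exact: mxi.
pose phi w := (xi w i ord0, xi w j ord0).
have mphi : measurable_fun [set: T] phi by exact/measurable_fun_pair.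
pose m' : {measure set (R * R) -> \bar R} := pushforward (mrestr P mE) phi.
pose m := m' mphi.
pose c0 := (\prod_(a < k | (a != i) && (a != j)) nrm (A a))%E.
have rectE (B1 B2 : set R) : measurable B1 -> measurable B2 ->
    P (phi @^-1` (B1 `*` B2) `&` E) = (nrm B1 * (nrm B2 * c0))%E.
  move=> mB1 mB2.
  pose B a := if a == i then B1 else if a == j then B2 else A a.
  transitivity (P (\bigcap_a ((fun w => xi w a ord0) @^-1` B a))).
    congr (P _); apply/seteqP; split=> w /=.
      move=> [[Bi Bj] Ew] a _; rewrite /= /B; case: eqP => [-> //|/eqP ai].
      by case: eqP => [-> //|/eqP aj]; apply: Ew; rewrite /= ai.
    move=> Bw; split.
      split; first by have := Bw i Logic.I; rewrite /= /B eqxx.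
      by have := Bw j Logic.I; rewrite /= /B ji eqxx.
    by move=> a /= /andP[ai aj]; have := Bw a Logic.I; rewrite /= /B (negbTE ai) (negbTE aj).
  rewrite ind; last by move=> a; rewrite /B; case: ifP => // _; case: ifP.
  rewrite (bigD1 i) //= (bigD1 j) /=; last by rewrite ji.
  rewrite {1 2}/B eqxx ji eqxx; congr (_ * (_ * _))%E.
  by apply: eq_bigr => a /andP[ai aj]; rewrite /B (negbTE ai) (negbTE aj).
have PE : P E = c0.
  have := rectE setT setT measurableT measurableT.
  by rewrite setXTT preimage_setT setTI probability_setT !mul1e.
have c0E : c0 = (fine c0)%:E by rewrite fineK // -PE fin_num_measure.
have c0_ge0 : 0 <= fine c0 by rewrite -lee_fin -c0E -PE measure_ge0.
pose m2 : {measure set (R * R) -> \bar R} := mscale (NngNum c0_ge0) (gauss_plane sigma).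
have m12 : forall X : set (R * R), measurable X -> m X = m2 X.
  apply: plane_measure_unique.
    by rewrite /m /= /pushforward /mrestr preimage_setT setTI PE c0E ltry.
  move=> B1 B2 mB1 mB2; rewrite /m /= /pushforward /mrestr rectE //.
  by rewrite /m2 /= /mscale /= -c0E gauss_planeX // muleA muleC.
transitivity (m (rotation c s @^-1` (A i `*` A j))).
  rewrite /m /= /pushforward /mrestr; congr (P _); apply/seteqP; split=> w /=.
    move=> Gw; split.
      split; first by have := Gw i Logic.I; rewrite /= mul_givensE eqxx.
      by have := Gw j Logic.I; rewrite /= mul_givensE ji eqxx.
    move=> a /= /andP[ai aj]; have := Gw a Logic.I.
    by rewrite /= mul_givensE (negbTE ai) (negbTE aj).
  move=> [[Gi Gj] Ew] a _; rewrite /= mul_givensE; case: eqP => [-> //|/eqP ai].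
  by case: eqP => [-> //|/eqP aj]; apply: Ew; rewrite /= ai.
have mAA : measurable (A i `*` A j) by exact: measurableX.
rewrite m12; last by rewrite -[X in measurable X]setTI; exact: measurable_rotation.
rewrite /m2 /= /mscale /= -c0E gauss_plane_rotation // gauss_planeX //.
rewrite (bigD1 i) //= (bigD1 j) /=; last by rewrite ji.
by rewrite -/c0 muleC muleA.
Qed.

End Iid.

(** * Orthogonal matrices as products of plane rotations and flips *)

Section Orth.
Variables (R : realType) (k : nat).

Lemma givensK n (i j : 'I_k) (c s : R) (X : 'M[R]_(k, n)) : i != j ->
  c ^+ 2 + s ^+ 2 = 1 -> givens i j c (- s) *m (givens i j c s *m X) = X.
Proof.
move=> ij cs; have ji : (j == i) = false by rewrite eq_sym; exact: negbTE.
apply/matrixP => a b; rewrite !mul_givensE eqxx ji eqxx.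
case: eqP => [->|_]; [|case: eqP => [->|//]].
  by rewrite -[RHS]mul1r -cs; ring.
by rewrite -[RHS]mul1r -cs; ring.
Qed.

Lemma givens_gram n (i j : 'I_k) (c s : R) (X : 'M[R]_(k, n)) : i != j ->
  c ^+ 2 + s ^+ 2 = 1 ->
  (givens i j c s *m X)^T *m (givens i j c s *m X) = X^T *m X.
Proof.
move=> ij cs; have ji : (j == i) = false by rewrite eq_sym; exact: negbTE.
apply/matrixP => a b; rewrite !mxE.
under eq_bigr do rewrite mxE !mul_givensE.
under [RHS]eq_bigr do rewrite mxE.
rewrite (bigD1 i) //= (bigD1 j) /=; last by rewrite ji.
rewrite [RHS](bigD1 i) //= [in RHS](bigD1 j) /=; last by rewrite ji.
rewrite !eqxx ji !addrA; congr (_ + _).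
  rewrite -[RHS]mul1r -cs; ring.
by apply: eq_bigr => r /andP[/negbTE -> /negbTE ->].
Qed.

Variables (d : measure_display) (T : measurableType d) (P : probability T R).
Variables (sigma : R).
Hypothesis sigma0 : 0 < sigma.

Let good (O : 'M[R]_k) := forall xi : T -> 'cV[R]_k,
  iid_gaussian_noise P sigma xi -> iid_gaussian_noise P sigma (fun w => O *m xi w).

Let goodM O1 O2 : good O1 -> good O2 -> good (O1 *m O2).
Proof.
move=> g1 g2 xi /g2/g1; congr iid_gaussian_noise; apply/funext => w.
by rewrite mulmxA.
Qed.

(* Givens rotations clear the last non-trivial column of [O] above the diagonal. *)
Lemma iid_gaussian_orthogonal (O : 'M[R]_k) (xi : T -> 'cV[R]_k) :
  O^T *m O = 1%:M -> iid_gaussian_noise P sigma xi ->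
  iid_gaussian_noise P sigma (fun w => O *m xi w).
Proof.
suff main n : (n <= k)%N -> forall Q : 'M[R]_k, Q^T *m Q = 1%:M ->
    (forall a b : 'I_k, (n <= b)%N -> Q a b = (a == b)%:R) -> good Q.
  move=> OO; apply: (main k) => // a b; by rewrite leqNgt ltn_ord.
elim: n => [_ Q QQ Qb|n IH ltnk Q].
  move=> z; congr iid_gaussian_noise; apply/funext => w.
  suff -> : Q = 1%:M by rewrite mul1mx.
  by apply/matrixP => a b; rewrite Qb // mxE.
pose n0 := Ordinal ltnk.
(* Inner induction on the number of nonzero off-diagonal entries of column [n0]. *)
have [q] := ubnP #|[pred a : 'I_k | (a != n0) && (Q a n0 != 0)]|.
elim: q Q => // q IHq Q; rewrite ltnS => cardq QQ Qb.
have Qdot a b : \sum_r Q r a * Q r b = (a == b)%:R.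
  have /matrixP/(_ a b) := QQ; rewrite !mxE => <-.
  by apply: eq_bigr => r _; rewrite mxE.
(* Column [b] is already a unit vector, and orthogonality to it kills entry [b] of column [n0]. *)
have Q0 (b : 'I_k) : (n < b)%N -> Q b n0 = 0.
  move=> nb; have := Qdot b n0.
  rewrite (bigD1 b) //= Qb // eqxx mul1r big1 => [|r rb].
    by rewrite addr0 => ->; rewrite -val_eqE /= gtn_eqF.
  by rewrite Qb // (negbTE rb) mul0r.
case: (pickP [pred a : 'I_k | (a != n0) && (Q a n0 != 0)]) => [a /= /andP[an Qa]|none].
- have ltan : (a < n)%N.
    rewrite ltn_neqAle -val_eqE /= in an *; rewrite an leqNgt /=.
    by apply: contra Qa => /Q0 ->.
  pose r := Num.sqrt (Q n0 n0 ^+ 2 + Q a n0 ^+ 2).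
  have r2 : r ^+ 2 = Q n0 n0 ^+ 2 + Q a n0 ^+ 2.
    by rewrite sqr_sqrtr // addr_ge0 // sqr_ge0.
  have r0 : r != 0.
    rewrite gt_eqF // sqrtr_gt0 ltr_wpDl ?sqr_ge0 //.
    by rewrite exprn_even_gt0.
  (* Chosen so that entry [a] of the rotated column, [s * Q n0 n0 + c * Q a n0], is zero. *)
  pose c := Q n0 n0 / r; pose s := - (Q a n0 / r).
  have cs : c ^+ 2 + s ^+ 2 = 1.
    by rewrite sqrrN !expr_div_n -mulrDl -r2 divff // expf_neq0.
  have s0 : s != 0 by rewrite oppr_eq0 mulf_neq0 // invr_eq0.
  have na : n0 != a by rewrite eq_sym.
  have cs' : c ^+ 2 + (- s) ^+ 2 = 1 by rewrite sqrrN.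
  rewrite -(givensK Q na cs); apply: goodM.
    by move=> z; apply: iid_gaussian_givens => //; rewrite oppr_eq0.
  apply: IHq; last 2 first.
  + by rewrite givens_gram.
  + move=> b l lb; rewrite mul_givensE !Qb //.
    have -> : (n0 == l) = false by rewrite -val_eqE /= ltn_eqF.
    have -> : (a == l) = false.
      by rewrite -val_eqE /= ltn_eqF // (ltn_trans ltan).
    rewrite !mulr0 subr0 addr0.
    case: eqP => [->|_]; first by rewrite -val_eqE /= ltn_eqF.
    by case: eqP => [->|//]; rewrite -val_eqE /= ltn_eqF // (ltn_trans ltan).
  apply: leq_trans cardq; apply: proper_card; apply/properP; split.
    apply/fintype.subsetP => b; rewrite !inE mul_givensE => /andP[bn].
    rewrite bn (negbTE bn); by case: (eqVneq b a) => [->|].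
  exists a; rewrite !inE ?an ?Qa // mul_givensE (negbTE an) eqxx /=.
  by rewrite negbK /s /c; apply/eqP; field.
- have Qn a : a != n0 -> Q a n0 = 0.
    by move=> an; have := none a; rewrite /= an /= => /negbFE/eqP.
  have QnE (b : 'I_k) : (n <= b)%N -> b = n0 \/ (n < b)%N.
    by rewrite leq_eqVlt => /orP[/eqP e|]; [left; apply: val_inj|right].
  have sq : Q n0 n0 ^+ 2 = 1.
    have := Qdot n0 n0; rewrite (bigD1 n0) //= big1 ?addr0 ?eqxx // => b bn.
    by rewrite Qn // mul0r.
  (* The cleared column is a unit vector up to sign; a flip of coordinate [n0] corrects the sign. *)
  have [Q1|Q1] : Q n0 n0 = 1 \/ Q n0 n0 = -1.
    by move/eqP: sq; rewrite sqrf_eq1 => /orP[] /eqP; [left|right].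
    apply: IH => //; first exact: ltnW.
    move=> a b /QnE[->|]; last exact: Qb.
    by case: (eqVneq a n0) => [->//|an]; rewrite Qn.
  pose F : 'M[R]_k := diag_mx (\row_j (if j == n0 then -1 else 1)).
  have FE (X : 'M[R]_k) a b : (F *m X) a b = if a == n0 then - X a b else X a b.
    by rewrite mul_diag_mx !mxE; case: ifP => _; rewrite ?mulN1r ?mul1r.
  have FF : F *m (F *m Q) = Q.
    by apply/matrixP => a b; rewrite FE FE; case: (a == n0); rewrite ?opprK.
  rewrite -FF; apply: goodM; first by move=> z; exact: iid_gaussian_flip.
  apply: IH; first exact: ltnW.
    apply/matrixP => a b; have /matrixP/(_ a b) := QQ; rewrite !mxE => <-.
    by apply: eq_bigr => r _; rewrite mxE [in RHS]mxE !FE; case: (r == n0); rewrite ?mulrNN.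
  move=> a b /QnE[->|nb]; rewrite FE.
    by case: (eqVneq a n0) => [->|an]; rewrite ?Q1 ?opprK // Qn.
  rewrite Qb //; case: eqP => // ->; rewrite (_ : n0 == b = false) ?oppr0 //.
  by rewrite -val_eqE /= ltn_eqF.
Qed.
End Orth.

(** * The joint law and its integrals *)

Section Law.
Variables (R : realType) (d : measure_display) (T : measurableType d).
Variables (P : probability T R) (k : nat) (sigma : R).
Implicit Types (xi : T -> 'cV[R]_k).

Definition col_to_tuple (x : 'cV[R]_k) : k.-tuple R := [tuple x i ord0 | i < k].

Lemma col_to_tupleK x : tuple_to_col (col_to_tuple x) = x.
Proof. by apply/colP => i; rewrite mxE tnth_mktuple. Qed.

Lemma measurable_col_to_tuple xi :
  (forall i : 'I_k, measurable_fun [set: T] (fun w => xi w i ord0)) ->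
  measurable_fun [set: T] (fun w => col_to_tuple (xi w)).
Proof.
move=> mxi; apply/measurable_fun_tnthP => i.
rewrite [X in measurable_fun _ X](_ : _ = fun w => xi w i ord0) //.
by apply/funext => w /=; rewrite tnth_mktuple.
Qed.

Lemma tuple_measure_unique (m1 m2 : {measure set (k.-tuple R) -> \bar R}) :
  (m1 setT < +oo)%E ->
  (forall A : 'I_k -> set R, (forall i, measurable (A i)) ->
    m1 (\bigcap_i [set t | A i (tnth t i)]) = m2 (\bigcap_i [set t | A i (tnth t i)])) ->
  forall X : set (k.-tuple R), measurable X -> m1 X = m2 X.
Proof.
move=> m1T m12.
pose C : set (set (k.-tuple R)) :=
  [set C | exists2 A : 'I_k -> set R, (forall i, measurable (A i)) &
     C = \bigcap_i [set t | A i (tnth t i)]].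
have CI : setI_closed C.
  move=> /= _ _ [A mA ->] [B mB ->]; exists (fun i => A i `&` B i).
    by move=> i; exact: measurableI.
  by rewrite -bigcapI.
move=> X mX; apply: (measure_unique C (fun=> setT)) => //.
- apply/seteqP; split.
    apply: smallest_sub; first exact: smallest_sigma_algebra.
    rewrite -bigcup_seq => Y [i /= _ [A mA <-]]; apply: sub_sigma_algebra.
    exists (fun j => if j == i then A else setT); first by move=> j; case: ifP.
    rewrite setTI; apply/seteqP; split=> t /=.
      by move=> At j _ /=; case: eqP => // ->.
    by move=> /(_ i Logic.I); rewrite /= eqxx.
  apply: smallest_sub; first exact: sigma_algebra_measurable.
  move=> _ [A mA ->]; apply: fin_bigcap_measurable; first exact: finite_finset.
  move=> i _; rewrite -[X in measurable X]setTI.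
  exact: measurable_tnth.
- move=> _; exists (fun=> setT) => //.
  by apply/seteqP; split.
- by rewrite bigcup_const.
- by move=> _ [A mA ->]; exact: m12.
Qed.

(** Both laws give a box the same product of normal probabilities, and boxes form a generating
    family closed under intersection. *)
Lemma iid_gaussian_law xi xi' (B : set (k.-tuple R)) :
  iid_gaussian_noise P sigma xi -> iid_gaussian_noise P sigma xi' ->
  measurable B ->
  P ((fun w => col_to_tuple (xi w)) @^-1` B) = P ((fun w => col_to_tuple (xi' w)) @^-1` B).
Proof.
move=> /iid_gaussianP[mxi ixi] /iid_gaussianP[mxi' ixi'] mB.
have mt := measurable_col_to_tuple mxi; have mt' := measurable_col_to_tuple mxi'.
pose m : {measure set (k.-tuple R) -> \bar R} :=
  pushforward P (fun w => col_to_tuple (xi w)).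
pose m' : {measure set (k.-tuple R) -> \bar R} :=
  pushforward P (fun w => col_to_tuple (xi' w)).
suff : forall X : set (k.-tuple R), measurable X -> m mt X = m' mt' X by apply.
apply: tuple_measure_unique.
  by rewrite /m /= /pushforward preimage_setT probability_setT ltry.
move=> A mA; rewrite /m /m' /= /pushforward.
have E (z : T -> 'cV[R]_k) : (fun w => col_to_tuple (z w)) @^-1`
    (\bigcap_i [set t | A i (tnth t i)]) = \bigcap_i ((fun w => z w i ord0) @^-1` A i).
  by apply/seteqP; split=> w /= h i _; have := h i Logic.I; rewrite /= tnth_mktuple.
by rewrite !E ixi // ixi'.
Qed.

Lemma iid_gaussian_integral xi xi' (g : 'cV[R]_k -> R) :
  iid_gaussian_noise P sigma xi -> iid_gaussian_noise P sigma xi' ->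
  measurable_fun [set: k.-tuple R] (g \o @tuple_to_col R k) ->
  P.-integrable [set: T] (fun w => (g (xi w))%:E) ->
  P.-integrable [set: T] (fun w => (g (xi' w))%:E) /\
  Rintegral P [set: T] (fun w => g (xi' w)) = Rintegral P [set: T] (fun w => g (xi w)).
Proof.
move=> ixi ixi' mg intg.
have mt := measurable_col_to_tuple ixi.1; have mt' := measurable_col_to_tuple ixi'.1.
pose h : k.-tuple R -> \bar R := EFin \o g \o @tuple_to_col R k.
have mh : measurable_fun [set: k.-tuple R] h by exact/measurable_EFinP.
have hE (z : T -> 'cV[R]_k) : (fun w => (g (z w))%:E) = h \o (fun w => col_to_tuple (z w)).
  by apply/funext => w; rewrite /h /= col_to_tupleK.
pose m : {measure set (k.-tuple R) -> \bar R} :=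
  pushforward P (fun w => col_to_tuple (xi w)).
pose m' : {measure set (k.-tuple R) -> \bar R} :=
  pushforward P (fun w => col_to_tuple (xi' w)).
have mm' (f : k.-tuple R -> \bar R) : (\int[m mt]_t f t = \int[m' mt']_t f t)%E.
  apply: eq_measure_integral => A mA _; exact: iid_gaussian_law.
(* Change of variables for a signed function needs integrability on each side, so it is first
   transferred through the integral of the absolute value. *)
have intg' : P.-integrable [set: T] (fun w => (g (xi' w))%:E).
  rewrite hE; apply/integrableP; split; first exact: measurableT_comp.
  move: intg; rewrite hE => /integrableP[_].
  rewrite -(@ge0_integral_pushforward _ _ _ _ R _ mt P setT (fun t => `|h t|%E)) //;
    last exact: measurableT_comp.
  rewrite -(@ge0_integral_pushforward _ _ _ _ R _ mt' P setT (fun t => `|h t|%E)) //;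
    last exact: measurableT_comp.
  by rewrite (mm' (fun t => `|h t|%E)).
split=> //; rewrite /Rintegral; congr fine.
rewrite hE in intg; rewrite hE in intg'; rewrite !hE.
have := @integral_pushforward _ _ _ _ R _ mt P setT _ mh intg measurableT.
have := @integral_pushforward _ _ _ _ R _ mt' P setT _ mh intg' measurableT.
by rewrite !preimage_setT => <- <-; exact/esym/mm'.
Qed.
End Law.

(** * Residuals and covariances *)

Section Measurability.
Variable R : realType.

Lemma measurable_Rmod : measurable_fun [set: R] (@Rmod R).
Proof.
set a := Num.sqrt (pi *+ 2) : R.
apply: measurable_funB => //; apply: measurable_funM => //.
apply: nondecreasing_measurable => // x y xy.
rewrite ler_int; apply: le_floor; rewrite ler_wpM2r ?invr_ge0 ?sqrtr_ge0 //.
by rewrite lerD2r.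
Qed.

Lemma measurable_mulmx_tuple m n (A : 'M[R]_(m, n)) i :
  measurable_fun [set: n.-tuple R] (fun t => (A *m tuple_to_col t) i ord0).
Proof.
rewrite [X in measurable_fun _ X](_ : _ = fun t => \sum_j A i j * tnth t j); last first.
  by apply/funext => t; rewrite mxE; apply: eq_bigr => j _; rewrite mxE.
apply: measurable_sum => j; apply: measurable_funM => //.
exact: measurable_tnth.
Qed.

Lemma measurable_residual N M (S : 'M[R]_(N.*2 + M.*2)) Lat
    (f : 'cV[R]_(M.*2) -> 'cV[R]_(N.*2)) i : measurable_estimator f ->
  measurable_fun [set: _.-tuple R]
    ((fun x => residual S Lat f x i ord0) \o @tuple_to_col R (N.*2 + M.*2)).
Proof.
move=> mf; pose B := Lat^T *m Omega R M.*2 *m dsubmx (invmx S).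
rewrite [X in measurable_fun _ X](_ : _ = fun t =>
    (usubmx (invmx S) *m tuple_to_col t) i ord0 -
    f (tuple_to_col [tuple Rmod ((B *m tuple_to_col t) j ord0) | j < M.*2]) i ord0).
  apply: measurable_funB; first exact: measurable_mulmx_tuple.
  apply: (measurableT_comp (mf i)).
  apply/measurable_fun_tnthP => j.
  rewrite [X in measurable_fun _ X](_ : _ =
      @Rmod R \o (fun t => (B *m tuple_to_col t) j ord0)).
    by apply: measurableT_comp; [exact: measurable_Rmod|exact: measurable_mulmx_tuple].
  by apply/funext => t /=; rewrite tnth_mktuple.
apply/funext => t /=; rewrite /residual mxE [in X in _ + X]mxE mul_usub_mx.
congr (_ - f _ i ord0); apply/colP => j.
by rewrite mxE [RHS]mxE tnth_mktuple -mul_dsub_mx /B !mulmxA.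
Qed.

(** The assumption on residuals concerns squares only; mixed moments follow from the bound of
    [|u v|] by [u^2 + v^2]. *)
Lemma integrable_mul_of_sqr (d : measure_display) (T : measurableType d)
    (P : probability T R) (u v : T -> R) :
  measurable_fun [set: T] u -> measurable_fun [set: T] v ->
  P.-integrable [set: T] (fun w => (u w ^+ 2)%:E) ->
  P.-integrable [set: T] (fun w => (v w ^+ 2)%:E) ->
  P.-integrable [set: T] (fun w => (u w * v w)%:E).
Proof.
move=> mu mv iu iv.
apply: (@le_integrable _ _ _ P _ measurableT _
   ((fun w => (u w ^+ 2)%:E) \+ (fun w => (v w ^+ 2)%:E))%E) => //.
- by apply/measurable_EFinP; exact: measurable_funM.
- move=> w _; rewrite /= lee_fin [leRHS]ger0_norm ?addr_ge0 ?sqr_ge0 //.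
  by rewrite ler_norml; apply/andP; split; nra.
- exact: integrableD.
Qed.

End Measurability.

(** * Second moments under a linear map *)

Section Covariance.
Variables (R : realType) (d : measure_display) (T : measurableType d).
Variables (P : probability T R).

Lemma Rintegral_lincomb (I : finType) (c : I -> R) (F : I -> T -> R) :
  (forall i, P.-integrable [set: T] (fun w => (F i w)%:E)) ->
  P.-integrable [set: T] (fun w => (\sum_i c i * F i w)%:E) /\
  Rintegral P [set: T] (fun w => \sum_i c i * F i w) =
    \sum_i c i * Rintegral P [set: T] (F i).
Proof.
move=> iF.
have E : (fun w => (\sum_i c i * F i w)%:E) =
    (fun w => \sum_i ((c i)%:E * (F i w)%:E))%E.
  by apply/funext => w; rewrite -sumEFin.
have icF i : P.-integrable [set: T] (fun w => ((c i)%:E * (F i w)%:E)%E).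
  exact: integrableZl.
split; first by rewrite E; exact: integrable_sum.
rewrite /Rintegral E integral_sum //.
transitivity (fine (\sum_i (c i * Rintegral P [set: T] (F i))%:E)%E).
  congr fine; apply: eq_bigr => i _.
  by rewrite integralZl // EFinM /Rintegral fineK //; exact: integrable_fin_num.
by rewrite sumEFin.
Qed.

Lemma covariance_mulmx n (S : 'M[R]_n) (r : T -> 'cV[R]_n) (V : 'M[R]_n) :
  (forall i j, V i j = Rintegral P [set: T] (fun w => r w i ord0 * r w j ord0)) ->
  (forall i j, P.-integrable [set: T] (fun w => (r w i ord0 * r w j ord0)%:E)) ->
  forall i j,
  P.-integrable [set: T] (fun w => ((S *m r w) i ord0 * (S *m r w) j ord0)%:E) /\
  Rintegral P [set: T] (fun w => (S *m r w) i ord0 * (S *m r w) j ord0) =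
    (S *m V *m S^T) i j.
Proof.
move=> VE ir i j.
have E w : (S *m r w) i ord0 * (S *m r w) j ord0 =
    \sum_(p : 'I_n * 'I_n) (S i p.1 * S j p.2) * (r w p.1 ord0 * r w p.2 ord0).
  rewrite !mxE big_distrlr pair_bigA /=; apply: eq_bigr => p _.
  by rewrite mulrACA.
have [I1 I2] := @Rintegral_lincomb _ (fun p : 'I_n * 'I_n => S i p.1 * S j p.2)
  (fun p w => r w p.1 ord0 * r w p.2 ord0) (fun p => ir p.1 p.2).
under eq_fun do rewrite E; under eq_Rintegral do rewrite E.
split=> //; rewrite I2 !mxE.
under [RHS]eq_bigr => b _ do rewrite !mxE mulr_suml.
rewrite exchange_big pair_bigA /=; apply: eq_bigr => p _.
by rewrite ?mxE VE mulrAC.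
Qed.

End Covariance.

Lemma symplectic_det_sqr (R : realType) n (S : 'M[R]_(n.*2)) :
  symplectic S -> \det S ^+ 2 = 1.
Proof.
move=> /(congr1 determinant); rewrite !det_mulmx det_tr => e.
have O0 : \det (Omega R n.*2) != 0.
  by rewrite -unitfE -unitmxE Omega_unit.
by apply: (mulIf O0); rewrite mul1r -[RHS]e expr2 mulrAC.
Qed.

(** Decoding [O x] with [Tm] gives [Sd x_d] and [Sa x_a]. The lattice [Sa Lat] reads the same vector
    from [Sa x_a] as [Lat] does from [x_a], already before reduction, so the two syndromes
    coincide. *)
Lemma residual_mulmx (R : realType) N M (Senc Tm O : 'M[R]_(N.*2 + M.*2)) Lat
    (f : 'cV[R]_(M.*2) -> 'cV[R]_(N.*2)) Sd Sa x :
  Tm \in unitmx -> O = Tm *m block_mx Sd 0 0 Sa *m invmx Senc ->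
  Sa^T *m Omega R M.*2 *m Sa = Omega R M.*2 ->
  residual Tm (Sa *m Lat) (fun y => Sd *m f y) (O *m x) =
  Sd *m residual Senc Lat f x.
Proof.
move=> Tu -> SaS; rewrite /residual !mulmxA mulVmx // mul1mx -!mulmxA.
set v := invmx Senc *m x; rewrite -[v]vsubmxK mul_block_col !mul0mx addr0 add0r.
rewrite !col_mxKu !col_mxKd mulmxBr; congr (_ - _ *m f (Rmod_vec _)).
by rewrite trmx_mul -!mulmxA (mulmxA (Omega _ _)) (mulmxA Sa^T) (mulmxA Sa^T) SaS.
Qed.

Theorem theorem1 (R : realType) (N M : nat) (sigma : R)
    (d : measure_display) (T : measurableType d) (P : probability T R)
    (xi : T -> 'cV[R]_(N.*2 + M.*2)) :
  (1 <= N)%N -> (N <= M)%N -> 0 < sigma ->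
  iid_gaussian_noise P sigma xi ->
  forall (Senc : 'M[R]_(N.*2 + M.*2)) (Lat : 'M[R]_(M.*2))
         (f : 'cV[R]_(M.*2) -> 'cV[R]_(N.*2)),
    symplectic Senc -> sympl_integral Lat -> measurable_estimator f ->
    residual_L2 P xi Senc Lat f ->
    exists (G : nat -> R) (Lam : 'M[R]_(M.*2))
           (f' : 'cV[R]_(M.*2) -> 'cV[R]_(N.*2)),
      (forall i, (i < N)%N -> 1 <= G i) /\
      symplectic Lam /\
      measurable_estimator f' /\
      sympl_integral (Lam *m Lat) /\
      residual_L2 P xi (TMS_enc N M G) (Lam *m Lat) f' /\
      GM_error P xi (TMS_enc N M G) (Lam *m Lat) f' = GM_error P xi Senc Lat f.
Proof.
move=> _ NM sigma0 ixi Senc Lat f SS [Latu [A [AT LatE]]] mf L2.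
have [G [Sd [Sa [G1 SdS SaS Tu OO]]]] := modewise_decomposition NM SS.
set Tm := TMS_enc N M G in Tu OO *; set O := _ *m invmx Senc in OO.
have SaT : Sa^T *m Omega R M.*2 *m Sa = Omega R M.*2.
  exact: congruence_tr (Omega_sqr _ M) SaS.
have Sau : Sa \in unitmx := congruence_unit (Omega_sqr _ M) SaS.
pose f' y := Sd *m f y.
have mf' : measurable_estimator f'.
  move=> j; rewrite [X in measurable_fun _ X](_ : _ =
    fun t => \sum_l Sd j l * f (tuple_to_col t) l ord0); last first.
    by apply/funext => t; rewrite mxE.
  by apply: measurable_sum => l; apply: measurable_funM => //; exact: mf.
pose xi' w := O *m xi w.
have ixi' : iid_gaussian_noise P sigma xi'.
  by apply: iid_gaussian_orthogonal => //; exact: mulmx1C.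
pose r w := residual Senc Lat f (xi w).
pose r' x := residual Tm (Sa *m Lat) f' x.
have r'E w : r' (xi' w) = Sd *m r w by exact: residual_mulmx.
have mr i : measurable_fun [set: T] (fun w => r w i ord0).
  rewrite [X in measurable_fun _ X](_ : _ = ((fun x => residual Senc Lat f x i ord0)
     \o @tuple_to_col R _) \o (fun w => col_to_tuple (xi w))).
    apply: measurableT_comp; first exact: measurable_residual.
    exact: measurable_col_to_tuple ixi.1.
  by apply/funext => w /=; rewrite col_to_tupleK.
have irr i j : P.-integrable [set: T] (fun w => (r w i ord0 * r w j ord0)%:E).
  exact: integrable_mul_of_sqr (mr i) (mr j) (L2 i) (L2 j).
have cov i j : P.-integrable [set: T] (fun w => (r' (xi w) i ord0 * r' (xi w) j ord0)%:E) /\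
    Rintegral P [set: T] (fun w => r' (xi w) i ord0 * r' (xi w) j ord0) =
    (Sd *m Vout P xi Senc Lat f *m Sd^T) i j.
  have VE a b : Vout P xi Senc Lat f a b =
      Rintegral P [set: T] (fun w => r w a ord0 * r w b ord0) by rewrite mxE.
  have [I1 I2] := covariance_mulmx Sd VE irr i j.
  have mg : measurable_fun [set: _.-tuple R]
      ((fun x => r' x i ord0 * r' x j ord0) \o @tuple_to_col R (N.*2 + M.*2)).
    by apply: measurable_funM; exact: measurable_residual.
  (* Integrability is known along [xi'], where the new residual is [Sd r]; equality of laws carries
     it, with the value, back to [xi], the noise on which the new code is evaluated. *)
  have [|J1 J2] := iid_gaussian_integral ixi' ixi mg.
    by under eq_fun do rewrite r'E.
  split; first exact: J1.
  rewrite -I2; apply: (etrans J2).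
  by apply: eq_Rintegral => w _; rewrite r'E.
exists G, Sa, f'; split; first exact: G1.
split; first exact: SaS.
split; first exact: mf'.
split.
  split; first by rewrite unitmx_mul Sau.
  exists A; split=> //; rewrite trmx_mul -LatE.
  by rewrite -!mulmxA (mulmxA (Omega _ _)) (mulmxA Sa^T) (mulmxA Sa^T) SaT.
split.
  move=> i; have [+ _] := cov i i.
  by under eq_fun do rewrite -expr2.
rewrite /GM_error (_ : Vout _ _ _ (Sa *m _) _ = Sd *m Vout P xi Senc Lat f *m Sd^T).
  by rewrite !det_mulmx det_tr mulrAC -expr2 symplectic_det_sqr // mul1r.
by apply/matrixP => i j; rewrite mxE; exact: (cov i j).2.
Qed.
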